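(* Let $D\subset\mathbb C^n$ be a domain and let $p:D\to[0,\infty)$ be a function that is not identically zero, with $|p|=\{a\in D:p(a)>0\}$. Then $$l_D(p,\cdot)=\inf\{l_D(p_B,\cdot): B\subset |p|,\ 0<\#B<\infty\}.$$ In particular, $l_D(p,\cdot)=\inf\{l_D(p_B,\cdot):\varnothing\neq B\subset |p|\}$.
   Context: $\mathbb D$ is the open unit disc. For a subset $B$ of $D$, $p_B=p\,\chi_B$, where $\chi_B$ is the characteristic function of $B$. Generalized Lempert function: for $z\in D$, $$l_D(p,z)=\inf\Big\{\prod_{a\in|p|}|\lambda_{\psi,a}|^{p(a)}\Big\},$$ where the infimum is over all holomorphic $\psi:\mathbb D\to D$ with $\psi(0)=z$ for which for each $a\in|p|$ there is a point $\lambda_{\psi,a}\in\mathbb D$ with $\psi(\lambda_{\psi,a})=a$, and over all choices of these points (one point $\lambda_{\psi,a}$ for each $a\in|p|$); infinite products are understood as infima of finite partial products. If there is no such $\psi$, one defines $l_D(p,z)=\inf\{l_D(p_B,z):B\subset|p|,\ 0<\#B<\infty\}$. The function $l_D(p_B,\cdot)$ is defined in the same way with $p$ replaced by $p_B$. *)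

(* Defs.v *)
From HB Require Import structures.
From mathcomp Require Import all_boot all_order all_algebra finmap complex.
From mathcomp Require Import all_classical all_reals all_analysis.
Set Implicit Arguments. Unset Strict Implicit. Unset Printing Implicit Defensive.
Import Order.TTheory GRing.Theory Num.Theory.
Import numFieldNormedType.Exports ComplexField.
Local Open Scope classical_set_scope.
Local Open Scope ring_scope.
Local Open Scope complex_scope.

(* The library gives R[i] a numClosedFieldType structure, but attaches the
   topology and norm of a numFieldType only to abstract such types and to R^o. *)
HB.instance Definition _ (R : realType) := NormedModule.copy R[i] R[i]^o.

Section GeneralizedLempert.
Context {R : realType} {n : nat}.
Local Notation C := R[i].
Local Notation Cn := 'rV[C]_n.

Definition unit_disc : set C := [set z | `|z| < 1].

Definition is_domain (D : set Cn) : Prop := [/\ D !=set0, open D & connected D].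

(* The values of psi outside the unit disc are irrelevant. [derivable psi z 1]
   is convergence of (psi (z + h) - psi z) / h as h -> 0 in C, i.e. complex
   differentiability. *)
Definition holomorphic_disc (D : set Cn) (psi : C -> Cn) : Prop :=
  (forall z, unit_disc z -> D (psi z)) /\
  (forall z, unit_disc z -> derivable psi z 1).

Implicit Types (D B : set Cn) (p : Cn -> R) (z : Cn) (lam : Cn -> C).

(* |p|; a function on D is represented by a total one, read only on D. *)
Definition poles D p : set Cn := [set a | D a /\ 0 < p a].

(* p_B = p chi_B *)
Definition restr_poles p B : Cn -> R := fun a => p a * \1_B a.

(* Infimum of the finite partial products of |lam a| ^ p a over |p|. As all
   factors lie in [0, 1], this is the plain product when |p| is finite, see
   [pole_prod_finite] below. *)
Definition pole_prod D p lam : \bar R :=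
  ereal_inf [set (\prod_(a <- F) (Normc.normc (lam a) `^ p a))%:E
            | F in [set F : {fset Cn} | [set` F] `<=` poles D p]].

(* psi(0) = z, and lam selects a psi-preimage in the unit disc of each pole. *)
Definition competitor D p z (psi : C -> Cn) lam : Prop :=
  [/\ holomorphic_disc D psi, psi 0 = z &
      forall a, poles D p a -> unit_disc (lam a) /\ psi (lam a) = a].

(* The infimum over all competitors, +oo if there are none. *)
Definition lempert_inf D p z : \bar R :=
  ereal_inf [set x | exists psi lam,
                       competitor D p z psi lam /\ x = pole_prod D p lam].

(* If no disc passes through all the poles, the infimum is over the finite
   nonempty B `<=` |p|, for which l_D(p_B, z) is [lempert_inf] since a disc
   through finitely many points of a domain always exists. *)
Definition lempert D p z : \bar R :=
  if `[< exists psi lam, competitor D p z psi lam >] then lempert_inf D p z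
  else ereal_inf [set lempert_inf D (restr_poles p B) z
                 | B in [set B | [/\ B `<=` poles D p, B !=set0 & finite_set B]]].

Lemma poles_restr D p B : B `<=` poles D p -> poles D (restr_poles p B) = B.
Proof.
move=> sB; apply/seteqP; split=> a; rewrite /poles /restr_poles /= indicE.
  by case=> _; have [/set_mem//|_] := boolP (a \in B); rewrite mulr0 ltxx.
by move=> Ba; have [Da pa] := sB a Ba; rewrite mem_set// mulr1.
Qed.

Lemma pole_prod_finite D p lam : finite_set (poles D p) ->
  (forall a, poles D p a -> unit_disc (lam a)) ->
  pole_prod D p lam =
    (\big[*%R/1]_(a \in poles D p) (Normc.normc (lam a) `^ p a))%:E.
Proof.
move=> finS lam1; rewrite fsbig_finite//=.
have normc01 a : poles D p a -> 0 <= Normc.normc (lam a) `^ p a <= 1.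
  move=> Sa; rewrite powR_ge0/=; have := lam1 a Sa.
  rewrite /unit_disc /= normc_def ltcR => /ltW le1.
  have le0 : 0 <= Normc.normc (lam a) by case: (lam a) => x y; rewrite /= sqrtr_ge0.
  have <- : 1 `^ p a = 1 :> R by rewrite powR1.
  rewrite ge0_ler_powR// ?nnegrE//; first by case: Sa => _ /ltW.
  by case: (lam a) le1.
apply/eqP; rewrite eq_le; apply/andP; split.
  by apply: ereal_inf_lbound; exists (fset_set (poles D p)) => //=; rewrite fset_setK.
apply: le_ereal_inf_tmp => _ [F /= FS <-]; rewrite lee_fin.
rewrite (big_fsetID _ (mem F))/=.
have -> : [fset x in fset_set (poles D p) | x \in F]%fset = F.
  apply/fsetP => x; rewrite !inE/= in_fset_set// andbC.
  by have [xF|//] := boolP (x \in F); rewrite mem_set//; exact: FS.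
rewrite ler_piMr//; first by apply: prodr_ge0 => a _; exact: powR_ge0.
rewrite big_seq; apply: prodr_ile1 => a.
by rewrite !inE/= => /andP[]; rewrite in_fset_set// => /set_mem/normc01.
Qed.

End GeneralizedLempert.

(* Main.v *)
Require Import Defs.
From mathcomp Require Import all_boot all_order all_algebra finmap complex.
From mathcomp Require Import all_classical all_reals all_analysis.
From mathcomp Require Import ring lra.
Set Implicit Arguments. Unset Strict Implicit. Unset Printing Implicit Defensive.
Import Order.TTheory GRing.Theory Num.Theory.
Import numFieldNormedType.Exports ComplexField.
Local Open Scope classical_set_scope.
Local Open Scope ring_scope.
Local Open Scope complex_scope.

(** Put I for the infimum of [lempert_inf D (restr_poles p B) z] over the finite
    nonempty sets B of poles. Everything follows from the identity
    [lempert D p z = I] of [lempertE]: applied to p and to each restriction of p,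
    it turns both claims into monotonicity of infima, since restricting twice is
    restricting once.

    If no disc passes through all the poles, the identity is the definition. If
    some disc does, then lempert_inf D p z >= I because a partial product over a
    finite set F of poles is a value that the same disc gives to the weight
    restricted to F ([finite_restr_le_lempert_inf]). The content is the opposite
    inequality ([lempert_inf_le_restr]): a disc psi through some of the poles has
    to be replaced by a disc through all of them, at almost no cost for the
    finite set F of poles that matters.

    When the poles are uncountable, any disc through them has infinitely many
    factors below some constant q < 1, so its product is 0
    ([pole_prod_uncountable]), and there is nothing to do.

    When they are a sequence a_0, a_1, ..., dilate: z |-> psi (r z), with r < 1
    close to 1, has a relatively compact image in D and passes through the poles
    of F at the points lam a / r, which costs little. Then build discs f_0 =
    psi (r z), f_1, f_2, ... such that f_{k+1} agrees with f_k at all the points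
    fixed so far, passes through a_k at some new point, and differs from f_k by a
    function as small as desired on the disc of radius r_k, where r_k tends to 1
    ([disc_through]). The limit is the required disc. To make it pass through
    a_k, one uses peak functions, that is polynomials s with s(1) = 1, zero at
    the points fixed so far, of modulus almost at most 1 on the disc, and tiny
    away from 1 ([exists_peak]). As |s v| is at most about |v| near 1, adding
    s v moves the boundary value f(1) to f(1) + v while the image stays in D, as
    soon as D contains a ball about f(1) of radius larger than |v|
    ([adjust_push]). By connectedness of D finitely many such moves bring the
    boundary value to a_k ([adjust_reach]), and a last small correction makes the
    value a_k be taken at an interior point close to 1 ([adjust_hit]).

    No Cauchy theory is needed for the limit: the corrections are explicit
    polynomials, whose first order Taylor remainder is controlled together with
    their size ([jet_bound], [limit_disc]). *)

(** * Real-valued norms and limits of rapidly converging sequences *)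

Section RealNorm.
Context {R : realType}.
Local Notation C := R[i].

(** The norm of a complex normed space takes values in the complex numbers; its
    real part lives in an ordered field. *)
Definition rnorm {V : normedModType C} (x : V) : R := complex.Re `|x|.

Section Basics.
Context {V : normedModType C}.
Implicit Types x y : V.

Lemma normE x : `|x| = (rnorm x)%:C.
Proof. by apply/esym/RRe_real; rewrite normr_real. Qed.

Lemma rnorm_ge0 x : 0 <= rnorm x.
Proof. by have := normr_ge0 x; rewrite normE lecR. Qed.

Lemma rnormD x y : rnorm (x + y) <= rnorm x + rnorm y.
Proof. by have := ler_normD x y; rewrite !normE -rmorphD lecR. Qed.

Lemma rnormN x : rnorm (- x) = rnorm x.
Proof. by rewrite /rnorm normrN. Qed.

Lemma rnorm_distC x y : rnorm (x - y) = rnorm (y - x).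
Proof. by rewrite /rnorm distrC. Qed.

Lemma rnorm_distD z x y : rnorm (x - y) <= rnorm (x - z) + rnorm (z - y).
Proof. by rewrite -[x - y](subrKA z) rnormD. Qed.

Lemma rnormB x y : rnorm (x - y) <= rnorm x + rnorm y.
Proof. by rewrite (le_trans (rnormD _ _))// rnormN. Qed.

Lemma rnorm0 : rnorm (0 : V) = 0.
Proof. by rewrite /rnorm normr0. Qed.

Lemma rnorm0_eq0 x : rnorm x <= 0 -> x = 0.
Proof.
move=> x0; apply/eqP; rewrite -normr_eq0 normE.
by rewrite (@le_anti _ _ (rnorm x) 0) // x0 rnorm_ge0.
Qed.

Lemma rnormZ (c : C) x : rnorm (c *: x) = rnorm c * rnorm x.
Proof.
by apply: (@complexI R); rewrite rmorphM /= -!normE; exact: normrZ.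
Qed.

Lemma nbhs_rnormP x (P : set V) :
  nbhs x P <-> exists e : R, 0 < e /\ forall y, rnorm (y - x) < e -> P y.
Proof.
split=> [/nbhs_ballP[e /= e0 eP]|[e [e0 eP]]].
  exists (complex.Re e); split; first by have := e0; rewrite ltcE /= => /andP[].
  move=> y yx; apply: eP; rewrite -ball_normE /ball_ /= distrC normE.
  by move: e0 yx; case: e => a b; rewrite !ltcE /= => /andP[/eqP-> _] ->; rewrite eqxx.
apply/nbhs_ballP; exists e%:C => /=; first by rewrite ltcR.
by move=> y; rewrite -ball_normE /ball_ /= distrC normE ltcR => /eP.
Qed.

End Basics.

Lemma rnormM (c d : C) : rnorm (c * d) = rnorm c * rnorm d.
Proof. exact: (rnormZ c d). Qed.

Lemma rnorm1 : rnorm (1 : C) = 1.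
Proof. by rewrite /rnorm normr1. Qed.

Lemma rnormX (c : C) k : rnorm (c ^+ k) = rnorm c ^+ k.
Proof. by elim: k => [|k ih]; rewrite ?rnorm1// !exprS rnormM ih. Qed.

Lemma rnormV (c : C) : rnorm c^-1 = (rnorm c)^-1.
Proof.
have [->|c0] := eqVneq c 0; first by rewrite invr0 rnorm0 invr0.
have h : rnorm c^-1 * rnorm c = 1 by rewrite -rnormM mulVf// rnorm1.
have r0 : rnorm c != 0 by apply: contra_eq_neq h => ->; rewrite mulr0 eq_sym oner_eq0.
by apply: (mulIf r0); rewrite h mulVf.
Qed.

Lemma rnormR (x : R) : rnorm x%:C = `|x|.
Proof. by rewrite /rnorm normc_def /= expr0n /= addr0 sqrtr_sqr. Qed.

Lemma rnorm_sqr (c : C) : rnorm c ^+ 2 = complex.Re c ^+ 2 + complex.Im c ^+ 2.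
Proof.
rewrite /rnorm normc_def /= sqr_sqrtr//.
by rewrite addr_ge0// sqr_ge0.
Qed.

Lemma Re_le_rnorm (c : C) : `|complex.Re c| <= rnorm c.
Proof. by have := normc_ge_Re c; rewrite normE lecR. Qed.

Lemma Im_le_rnorm (c : C) : `|complex.Im c| <= rnorm c.
Proof.
have := rnorm_ge0 c; have := rnorm_sqr c => h h0.
rewrite -(ler_pXn2r (n := 2)) ?nnegrE// h real_normK ?num_real// lerDr.
exact: sqr_ge0.
Qed.

Lemma rnorm_le_ReIm (c : C) : rnorm c <= `|complex.Re c| + `|complex.Im c|.
Proof.
rewrite -(ler_pXn2r (n := 2)) ?nnegrE ?rnorm_ge0 ?addr_ge0// rnorm_sqr.
rewrite -[X in X + _ <= _]real_normK ?num_real//.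
rewrite -[X in _ + X <= _]real_normK ?num_real//.
by rewrite sqrrD lerD2r lerDl mulrn_wge0// mulr_ge0.
Qed.

Lemma unit_disc_rnorm (z : C) : unit_disc z <-> rnorm z < 1.
Proof. by rewrite /unit_disc /= normE ltcR. Qed.

End RealNorm.

Section Complete.
Context {R : realType}.
Local Notation C := R[i].

(** Nested intervals: the [a k - e k] increase, the [a k + e k] decrease. *)
Lemma real_rapid_lim (a e : nat -> R) :
  (forall k, e k.+1 <= e k / 2) -> (forall k, `|a k.+1 - a k| <= e k / 2) ->
  exists L, forall k, `|L - a k| <= e k.
Proof.
move=> eS aS.
have e0 k : 0 <= e k by have := aS k; have := normr_ge0 (a k.+1 - a k); lra.
have mono k j : a k - e k <= a (k + j)%N - e (k + j)%N
    /\ a (k + j)%N + e (k + j)%N <= a k + e k.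
  elim: j => [|j [ih1 ih2]]; rewrite ?addn0 ?addnS//.
  have := aS (k + j)%N; have := eS (k + j)%N; have := e0 (k + j)%N.
  by rewrite ler_norml => ? ? /andP[? ?]; split; lra.
have bnd k j : a k - e k <= a j + e j.
  have [_ h1] := mono j k; have [h2 _] := mono k j.
  by move: h1; rewrite addnC; have := e0 (k + j)%N; lra.
have hs : has_sup [set a k - e k | k in setT].
  split; first by exists (a 0%N - e 0%N); exists 0%N.
  by exists (a 0%N + e 0%N) => _ [k _ <-].
exists (sup [set a k - e k | k in setT]) => k.
have h1 : a k - e k <= sup [set a k - e k | k in setT].
  by apply: ub_le_sup; [case: hs | exists k].
have h2 : sup [set a k - e k | k in setT] <= a k + e k.
  by apply: ge_sup; [case: hs | move=> _ [j _ <-]].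
by rewrite ler_norml; apply/andP; split; lra.
Qed.

(** The factor 2 is the price of treating the two coordinates separately; it is
    removed in [rapid_lim]. *)
Lemma complex_rapid_lim (a : nat -> C) (e : nat -> R) :
  (forall k, e k.+1 <= e k / 2) -> (forall k, rnorm (a k.+1 - a k) <= e k / 2) ->
  exists L, forall k, rnorm (L - a k) <= 2 * e k.
Proof.
move=> eS aS.
have [x xP] : exists L, forall k, `|L - complex.Re (a k)| <= e k.
  apply: real_rapid_lim => // k.
  by rewrite -raddfB (le_trans (Re_le_rnorm _)).
have [y yP] : exists L, forall k, `|L - complex.Im (a k)| <= e k.
  apply: real_rapid_lim => // k.
  by rewrite -raddfB (le_trans (Im_le_rnorm _)).
exists (x +i* y) => k; rewrite (le_trans (rnorm_le_ReIm _))//.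
have := xP k; have := yP k; rewrite !raddfB /=; lra.
Qed.

(** From [e k * (k + 1) <= e 0]. *)
Lemma halving_bound (e : nat -> R) : (forall k, 0 <= e k) -> (forall k, e k.+1 <= e k / 2) ->
  forall d, 0 < d -> exists K, forall k, (K <= k)%N -> e k <= d.
Proof.
move=> e0 eS d d0.
have le k : e k * k.+1%:R <= e 0%N.
  elim: k => [|k ih]; first by rewrite mulr1.
  rewrite -[k.+2%:R]natr1; rewrite -[k.+1%:R]natr1 in ih *.
  have x0 : 0 <= k%:R :> R by [].
  move: (k%:R) x0 ih => x x0; apply: le_trans.
  have h : 0 <= e k * x by rewrite mulr_ge0.
  have h2 : e k.+1 * (x + 1 + 1) <= e k / 2 * (x + 1 + 1).
    by rewrite ler_wpM2r// !addr_ge0.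
  lra.
have [K HK] : exists K : nat, e 0%N / d <= K%:R.
  exists (Num.Def.archi_bound (e 0%N / d)); apply/ltW/archi_boundP.
  by rewrite divr_ge0// ltW.
exists K => k Kk; have := le k.
move: HK; rewrite ler_pdivrMr// => HK.
have : K%:R <= k%:R :> R by rewrite ler_nat.
rewrite -natr1 => Kk'.
have := e0 k; have : 0 <= K%:R :> R by [].
have [//|dek] := lerP (e k) d.
set x := k%:R in Kk' * => K0 ek0 h; move: h.
have h1 : d * x <= e k * x by rewrite ler_wpM2r ?(le_trans K0)// ltW.
have h2 : K%:R * d <= d * x by rewrite mulrC ler_wpM2l// ltW.
by rewrite mulrDr mulr1; lra.
Qed.

Lemma rnorm_entry_le n (x : 'rV[C]_n) j : rnorm (x ord0 j) <= rnorm x.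
Proof.
rewrite -lecR -!normE [leRHS]/Num.Def.normr /= mx_normE.
have := le_bigmax (0%:nng : {nonneg C}) (fun i => `|x i.1 i.2|%:nng) (ord0, j).
exact.
Qed.

Lemma rnorm_row_le n (x : 'rV[C]_n) (b : R) : 0 <= b ->
  (forall j, rnorm (x ord0 j) <= b) -> rnorm x <= b.
Proof.
move=> b0 xb; rewrite -lecR -normE [leLHS]/Num.Def.normr /=.
have [->|/mx_norm_neq0[[i j] ->]] := eqVneq (mx_norm x) 0; first by rewrite lecR.
by rewrite /= ord1 normE lecR.
Qed.

(** The limit L does not depend on m, so one L serves all the stages from which
    the steps are controlled. The rate, lost up to a factor coordinatewise, is
    recovered by letting j grow in |L - u m| <= |L - u (m + j)| +
    |u (m + j) - u m|, where the last term telescopes. *)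
Lemma rapid_lim n (u : nat -> 'rV[C]_n) (e : nat -> R) :
  (forall k, 0 <= e k) -> (forall k, e k.+1 <= e k / 2) ->
  exists L, forall m,
    (forall k, (m <= k)%N -> rnorm (u k.+1 - u k) <= e k / 2) ->
    rnorm (L - u m) <= e m.
Proof.
move=> e0 eS.
have [[m0 um0]|no] := pselect (exists m,
    forall k, (m <= k)%N -> rnorm (u k.+1 - u k) <= e k / 2); last first.
  by exists 0 => m um; case: no; exists m.
have /choice[L LP] (j : 'I_n) : exists l, forall k,
    rnorm (l - u (m0 + k)%N ord0 j) <= 2 * e (m0 + k)%N.
  apply: (@complex_rapid_lim (fun k => u (m0 + k)%N ord0 j)
                             (fun k => e (m0 + k)%N)) => k; rewrite addnS//.
  apply: le_trans (um0 _ (leq_addr k m0)).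
  by have := rnorm_entry_le (u (m0 + k).+1 - u (m0 + k)%N) j; rewrite !mxE.
exists (\row_j L j) => m um.
have far k : (m0 <= k)%N -> rnorm (\row_j L j - u k) <= 2 * e k.
  move=> m0k; apply: rnorm_row_le => [|j]; first by rewrite mulr_ge0.
  by rewrite !mxE -(subnKC m0k).
have tele k : rnorm (u (m + k)%N - u m) <= e m - e (m + k)%N.
  elim: k => [|k ih]; first by rewrite addn0 !subrr rnorm0.
  rewrite addnS (le_trans (rnorm_distD (u (m + k)%N) _ _))//.
  have := um _ (leq_addr k m); have := eS (m + k)%N; lra.
apply/ler_addgt0Pr => d d0.
have [K KP] := halving_bound e0 eS d0.
set k := maxn m0 K.
have h1 := far (m + k)%N (leq_trans (leq_maxl m0 K) (leq_addl _ _)).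
have h2 := KP (m + k)%N (leq_trans (leq_maxr m0 K) (leq_addl _ _)).
have := tele k; have := rnorm_distD (u (m + k)%N) (\row_j L j) (u m); lra.
Qed.

End Complete.

(** * Complex differentiability in epsilon-delta form *)

Section Differentiability.
Context {R : realType} {V : normedModType R[i]}.
Local Notation C := R[i].
Implicit Types (f g : C -> V) (z w : C) (l : V).

Definition has_cderiv f z l := forall e : R, 0 < e -> exists d : R, 0 < d /\
  forall w, rnorm (w - z) < d ->
    rnorm (f w - f z - (w - z) *: l) <= e * rnorm (w - z).

Lemma derivable_has_cderiv f z : derivable f z 1 <-> exists l, has_cderiv f z l.
Proof.
rewrite /derivable; split=> [/cvg_ex[l fl]|[l fl]].
  exists l => e e0.
  have /fl : nbhs l [set x | rnorm (x - l) < e] by apply/nbhs_rnormP; exists e.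
  rewrite /= /nbhs /= /dnbhs /within /= => /nbhs_rnormP[d [d0 dP]].
  exists d; split=> // w wz.
  have [->|wNz] := eqVneq w z.
    by rewrite !subrr scale0r subr0 !rnorm0 mulr0.
  have wz0 : w - z != 0 by rewrite subr_eq0.
  have := dP (w - z); rewrite subr0 => /(_ wz wz0) /ltW.
  have -> : (w - z) *: (1 : C) = w - z by rewrite /GRing.scale /= mulr1.
  rewrite subrK => h.
  have -> : f w - f z - (w - z) *: l = (w - z) *: ((w - z)^-1 *: (f w - f z) - l).
    by rewrite scalerBr scalerA mulfV// scale1r.
  by rewrite rnormZ mulrC ler_wpM2r// rnorm_ge0.
apply/cvg_ex; exists l => P /nbhs_rnormP[e [e0 eP]].
have e20 : 0 < e / 2 by rewrite divr_gt0.
have [d [d0 dP]] := fl _ e20.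
rewrite /= /nbhs /= /dnbhs /within /=; apply/nbhs_rnormP; exists d; split=> // h.
rewrite subr0 => hd h0; apply: eP => /=.
have -> : h *: (1 : C) = h by rewrite /GRing.scale /= mulr1.
have := dP (h + z); rewrite addrK => /(_ hd) {}dP.
have -> : h^-1 *: (f (h + z) - f z) - l = h^-1 *: (f (h + z) - f z - h *: l).
  by rewrite [RHS]scalerBr scalerA mulVf// scale1r.
have rh0 : 0 < rnorm h.
  by rewrite lt_neqAle rnorm_ge0 andbT eq_sym; apply: contra_neq h0 => h0; apply: rnorm0_eq0; rewrite h0.
rewrite rnormZ rnormV mulrC ltr_pdivrMr// (le_lt_trans dP)// ltr_pM2r//.
by rewrite ltr_pdivrMr// ltr_pMr// ltr1n.
Qed.

Lemma has_cderiv_cont f z l : has_cderiv f z l ->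
  forall e : R, 0 < e -> exists d : R, 0 < d /\
    forall w, rnorm (w - z) < d -> rnorm (f w - f z) < e.
Proof.
move=> fl e e0; have [d [d0 dP]] := fl 1 ltr01.
have c0 : 0 < 1 + rnorm l by rewrite ltr_pwDl// rnorm_ge0.
exists (Num.min d (e / (1 + rnorm l))); split.
  by rewrite lt_min d0 divr_gt0.
move=> w; rewrite lt_min => /andP[/dP h]; rewrite ltr_pdivlMr// => we.
have := rnormD (f w - f z - (w - z) *: l) ((w - z) *: l).
rewrite subrK rnormZ; lra.
Qed.

Lemma has_cderivD f g z l m : has_cderiv f z l -> has_cderiv g z m ->
  has_cderiv (fun w => f w + g w) z (l + m).
Proof.
move=> fl gm e e0; have e20 : 0 < e / 2 by rewrite divr_gt0.
have [d [d0 dP]] := fl _ e20; have [d' [d'0 d'P]] := gm _ e20.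
exists (Num.min d d'); split; first by rewrite lt_min d0.
move=> w; rewrite lt_min => /andP[/dP h /d'P h'].
have -> : f w + g w - (f z + g z) - (w - z) *: (l + m) =
    (f w - f z - (w - z) *: l) + (g w - g z - (w - z) *: m).
  by rewrite scalerDr !opprD (addrACA (f w)) [LHS]addrACA.
by apply: le_trans (rnormD _ _) _; lra.
Qed.

End Differentiability.

Section Compactness.
Context {R : realType}.
Local Notation C := R[i].

(** Compactness of the closed disc of radius r. The square of side 2 r is compact
    as a product of segments, and a point of the square outside the disc has a
    neighbourhood that misses the disc. *)
Lemma disc_uniform (r : R) (Q : R -> C -> Prop) :
  (forall e e' z, 0 < e' -> e' <= e -> Q e z -> Q e' z) ->
  (forall z, rnorm z <= r -> exists e d : R, [/\ 0 < e, 0 < d &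
     forall w, rnorm (w - z) < d -> rnorm w <= r -> Q e w]) ->
  exists e, 0 < e /\ forall z, rnorm z <= r -> Q e z.
Proof.
move=> Qmono Qloc.
pose K : set (R * R) := `[- r, r]%classic `*` `[- r, r]%classic.
have cK : compact K by apply: compact_setX; exact: segment_compact.
have /compact_near_coveringP ncK := cK.
pose P (e : R) (u : R * R) := rnorm (u.1 +i* u.2) <= r -> Q e (u.1 +i* u.2).
have dist (u v : R * R) :
    rnorm ((v.1 +i* v.2) - (u.1 +i* u.2)) <= `|v.1 - u.1| + `|v.2 - u.2|.
  exact: rnorm_le_ReIm.
have loc : forall u, K u ->
    \forall u' \near u & e \near (0:R)^'+, P e u'.
  move=> u _.
  have nb d : 0 < d -> nbhs u (ball u.1 (d / 2) `*` ball u.2 (d / 2) : set (R * R)).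
    move=> d0; exists (ball u.1 (d / 2), ball u.2 (d / 2)) => //=.
    by split; apply: nbhsx_ballx; rewrite divr_gt0.
  have [ur|ur] := lerP (rnorm (u.1 +i* u.2)) r.
    have [e [d [e0 d0 h]]] := Qloc _ ur.
    exists (ball u.1 (d / 2) `*` ball u.2 (d / 2), [set e' | 0 < e' <= e]).
      split; first exact: nb.
      near=> e'; apply/andP; split; near: e'; first exact: nbhs_right_gt.
      exact: nbhs_right_le.
    move=> [v e'] [/= [v1 v2] /andP[e'0 e'e]] vr; apply: Qmono e'0 e'e _.
    apply: h => //; apply: le_lt_trans (dist _ _) _.
    move: v1 v2; rewrite /ball /= => v1 v2.
    by rewrite distrC [X in _ + X]distrC; lra.
  set d := rnorm (u.1 +i* u.2) - r.
  have d0 : 0 < d by rewrite subr_gt0.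
  exists (ball u.1 (d / 2) `*` ball u.2 (d / 2), setT).
    by split; [exact: nb | exact: filterT].
  move=> [v e'] [/= [v1 v2] _] vr.
  have := le_lt_trans (rnorm_distD 0 (u.1 +i* u.2) (v.1 +i* v.2)).
  have := dist v u; move: v1 v2; rewrite /ball /= => v1 v2 h.
  have := rnormD ((u.1 +i* u.2) - (v.1 +i* v.2)) (v.1 +i* v.2).
  by rewrite subrK; move: h vr; rewrite /d in v1 v2; lra.
have KP := ncK R (0:R)^'+ P _ loc.
have [e [e0 eP]] : exists e, 0 < e /\ K `<=` P e.
  have pos : \forall e \near (0:R)^'+, 0 < e by exact: nbhs_right_gt.
  have [e [e0 eP]] := filter_ex (filterI pos (KP _)).
  by exists e.
exists e; split=> // -[x y] zr; apply: (eP (x, y)) => //=.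
split; rewrite /= in_itv /= -ler_norml; apply: le_trans zr.
  exact: (Re_le_rnorm (x +i* y)).
exact: (Im_le_rnorm (x +i* y)).
Unshelve. all: by end_near.
Qed.

End Compactness.

(** * Peak functions with controlled jets *)

Section Jets.
Context {R : realType}.
Local Notation C := R[i].

(** Size, derivative and first order Taylor remainder of s are at most M on the
    closed disc of radius r. For bounds summable in k this makes the sum of a
    series of functions differentiable, with the sum of the derivatives as its
    derivative. *)
Definition jet_bound {V : normedModType C} (s s' : C -> V) (r M : R) :=
  forall z, rnorm z <= r ->
    [/\ rnorm (s z) <= M, rnorm (s' z) <= M &
        forall w, rnorm w <= r ->
          rnorm (s w - s z - (w - z) *: s' z) <= M * rnorm (w - z) ^+ 2].

Section Generic.
Context {V : normedModType C}.
Implicit Types (s t : C -> V) (f : C -> C).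

Lemma jet_bound_le s s' r r' M M' : r' <= r -> M <= M' ->
  jet_bound s s' r M -> jet_bound s s' r' M'.
Proof.
move=> rr MM js z zr; have [h1 h2 h3] := js z (le_trans zr rr).
split; [exact: le_trans MM|exact: le_trans MM|move=> w wr].
apply: le_trans (h3 _ (le_trans wr rr)) _.
by rewrite ler_wpM2r// sqr_ge0.
Qed.

Lemma disc_dist_le2 (r : R) (z w : C) : r <= 1 -> rnorm z <= r -> rnorm w <= r ->
  rnorm (w - z) <= 2.
Proof. by move=> ? ? ?; have := rnormB w z; lra. Qed.

Lemma jet_bound_lip s s' r M z w : r <= 1 -> jet_bound s s' r M ->
  rnorm z <= r -> rnorm w <= r -> rnorm (s w - s z) <= 3 * M * rnorm (w - z).
Proof.
move=> r1 js zr wr; have [h1 h2 /(_ _ wr) h3] := js z zr.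
have := rnormD (s w - s z - (w - z) *: s' z) ((w - z) *: s' z).
rewrite subrK rnormZ; move: h3.
have := disc_dist_le2 r1 zr wr; have := rnorm_ge0 (w - z).
have := rnorm_ge0 (s z).
move: (rnorm (w - z)) h1 h2 => d h1 h2 s0 d0 d2 h3 h4.
have M0 : 0 <= M by lra.
have : d * rnorm (s' z) <= d * M by rewrite ler_wpM2l.
have : M * d * d <= M * d * 2 by rewrite ler_wpM2l// mulr_ge0.
rewrite expr2 in h3; lra.
Qed.

Lemma jet_bound_has_cderiv s s' r M z : jet_bound s s' r M -> rnorm z < r ->
  has_cderiv s z (s' z).
Proof.
move=> js zr e e0; have [h1 _ h3] := js z (ltW zr).
have M0 : 0 <= M by apply: le_trans h1; exact: rnorm_ge0.
have M1 : 0 < M + 1 by lra.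
exists (Num.min (r - rnorm z) (e / (M + 1))); split.
  by rewrite lt_min subr_gt0 zr divr_gt0.
move=> w; rewrite lt_min => /andP[wr]; rewrite ltr_pdivlMr// => we.
apply: le_trans (h3 w _) _.
  by have := rnormD (w - z) z; rewrite subrK; lra.
rewrite expr2 mulrA ler_wpM2r ?rnorm_ge0//.
by have := rnorm_ge0 (w - z); lra.
Qed.

Lemma jet_bound_cst (v : V) r : jet_bound (fun=> v) (fun=> 0) r (rnorm v).
Proof.
move=> z _; split; rewrite ?rnorm0 ?rnorm_ge0// => w _.
by rewrite subrr scaler0 subr0 rnorm0 mulr_ge0 ?rnorm_ge0 ?sqr_ge0.
Qed.

Lemma jet_boundD s s' t t' r M M' : jet_bound s s' r M -> jet_bound t t' r M' ->
  jet_bound (fun z => s z + t z) (fun z => s' z + t' z) r (M + M').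
Proof.
move=> js jt z zr; have [a1 a2 a3] := js z zr; have [b1 b2 b3] := jt z zr.
split; [apply: le_trans (rnormD _ _) _; lra
       |apply: le_trans (rnormD _ _) _; lra|move=> w wr].
have -> : s w + t w - (s z + t z) - (w - z) *: (s' z + t' z) =
    (s w - s z - (w - z) *: s' z) + (t w - t z - (w - z) *: t' z).
  by rewrite scalerDr !opprD (addrACA (s w)) [LHS]addrACA.
by apply: le_trans (rnormD _ _) _; have := a3 w wr; have := b3 w wr; lra.
Qed.

Let product_remainder (d fw fz f' : C) (sw sz s' : V) :
  fw *: sw - fz *: sz - d *: (fz *: s' + f' *: sz) =
  (fw - fz - d *: f') *: sw + fz *: (sw - sz - d *: s') + (d * f') *: (sw - sz).
Proof.
rewrite -[d *: f']/(d * f') !scalerBl !scalerBr !scalerDr !scalerA [fz * d]mulrC.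
set A := fw *: sw; set B := fz *: sw; set D := fz *: sz.
set E := (d * fz) *: s'; set F := _ *: sw; set G := (d * f') *: sz.
rewrite -[RHS]addrA -[B - D - E]addrA (addrACA B) -[A - B - F]addrA -opprD.
by rewrite addrA subrK opprD !addrA.
Qed.

(** Write df, ds, dz for the increments from z to w. The remainder of the product
    is (df - dz f' z) s w + f z (ds - dz s' z) + dz (f' z) ds, whose last term is
    at most 3 M M' |dz|^2 by [jet_bound_lip]; hence the constant 5. *)
Lemma jet_boundZ f f' s s' r M M' : r <= 1 ->
  jet_bound f f' r M -> jet_bound s s' r M' ->
  jet_bound (fun z => f z *: s z) (fun z => f z *: s' z + f' z *: s z)
    r (5 * M * M').
Proof.
move=> r1 jf js z zr; have [a1 a2 a3] := jf z zr; have [b1 b2 b3] := js z zr.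
have ub (c : C) (v : V) : rnorm c <= M -> rnorm v <= M' -> rnorm (c *: v) <= M * M'.
  by move=> cM vM; rewrite rnormZ ler_pM ?rnorm_ge0.
have M0 : 0 <= M by apply: le_trans a1; exact: rnorm_ge0.
have M'0 : 0 <= M' by apply: le_trans b1; exact: rnorm_ge0.
have MM : 0 <= M * M' by rewrite mulr_ge0.
split.
- by apply: le_trans (ub _ _ a1 b1) _; lra.
- apply: le_trans (rnormD _ _) _.
  by have := ub _ _ a1 b2; have := ub _ _ a2 b1; lra.
move=> w wr; have [c1 _ _] := js w wr.
have -> : f w *: s w - f z *: s z - (w - z) *: (f z *: s' z + f' z *: s z) =
  (f w - f z - (w - z) *: f' z) *: s w + f z *: (s w - s z - (w - z) *: s' z)
  + ((w - z) * f' z) *: (s w - s z).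
  exact: product_remainder.
apply: le_trans (rnormD _ _) _; set d := rnorm (w - z).
have d0 : 0 <= d by exact: rnorm_ge0.
have t3 : rnorm (((w - z) * f' z) *: (s w - s z)) <= 3 * (M * M') * d ^+ 2.
  rewrite rnormZ rnormM -/d.
  have := jet_bound_lip r1 js zr wr; rewrite -/d => h.
  have -> : 3 * (M * M') * d ^+ 2 = (d * M) * (3 * M' * d) by ring.
  by apply: ler_pM; rewrite ?mulr_ge0 ?rnorm_ge0// ler_wpM2l.
have t1 : rnorm ((f w - f z - (w - z) *: f' z) *: s w) <= (M * M') * d ^+ 2.
  rewrite rnormZ; have -> : M * M' * d ^+ 2 = (M * d ^+ 2) * M' by ring.
  by apply: ler_pM; rewrite ?rnorm_ge0// a3.
have t2 : rnorm (f z *: (s w - s z - (w - z) *: s' z)) <= (M * M') * d ^+ 2.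
  rewrite rnormZ -mulrA.
  by apply: ler_pM; rewrite ?rnorm_ge0// b3.
have := rnormD ((f w - f z - (w - z) *: f' z) *: s w)
  (f z *: (s w - s z - (w - z) *: s' z)).
rewrite -[5 * M * M']mulrA; lra.
Qed.

End Generic.

Lemma jet_bound_affine (a b : C) r : r <= 1 ->
  jet_bound (fun z => a * z + b) (fun=> a) r (rnorm a + rnorm b).
Proof.
move=> r1 z zr; split.
- apply: le_trans (rnormD _ _) _; rewrite rnormM lerD2r.
  by rewrite ler_piMr ?rnorm_ge0//; lra.
- by have := rnorm_ge0 b; lra.
move=> w wr; rewrite [X in rnorm X](_ : _ = 0); last first.
  by rewrite /GRing.scale /=; ring.
by rewrite rnorm0 mulr_ge0 ?addr_ge0 ?rnorm_ge0 ?sqr_ge0.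
Qed.

(** A product of affine factors (z - x) / (1 - x). *)
Lemma exists_interpolant (l : seq C) : (forall x, x \in l -> x != 1) ->
  exists T T' M, [/\ T 1 = 1, forall x, x \in l -> T x = 0 &
    jet_bound (T : C -> C) T' 1 M].
Proof.
elim: l => [_|x l ih lP].
  by exists (fun=> 1), (fun=> 0), (rnorm (1 : C)); split=> //; exact: jet_bound_cst.
have [|T [T' [M [T1 Tl jT]]]] := ih.
  by move=> y yl; apply: lP; rewrite inE yl orbT.
have x1 : 1 - x != 0 by rewrite subr_eq0 eq_sym lP// inE eqxx.
do 3!eexists; split; last first.
- exact: (jet_boundZ (lexx _) (@jet_bound_affine (1 - x)^-1 (- x / (1 - x)) _ (lexx _)) jT).
- move=> y; rewrite inE => /orP[/eqP->|/Tl->]; last by rewrite scaler0.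
  by rewrite -[_ + _]/(_ + _) mulrC -mulrDl subrr mul0r scale0r.
- by rewrite /= T1 mulr1 -[X in X + _]mul1r -mulrDl mulfV// scale1r.
Qed.

(** By induction on k, from a^(k+2) - b^(k+2) - (k+2) b^(k+1) (a - b) =
    a (a^(k+1) - b^(k+1) - (k+1) b^k (a - b)) + (k+1) b^k (a - b)^2. The bound
    rho >= 1/2 serves to trade rho^k for 4 rho^(k+2). *)
Lemma expn_remainder (rho : R) (a b : C) k : 1 / 2 <= rho ->
  rnorm a <= rho -> rnorm b <= rho ->
  rnorm (a ^+ k.+1 - b ^+ k.+1 - k.+1%:R * b ^+ k * (a - b))
    <= 4 * k.+1%:R ^+ 2 * rho ^+ k.+1 * rnorm (a - b) ^+ 2.
Proof.
move=> rho2 ar br; have rho0 : 0 <= rho by lra.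
have d20 : 0 <= rnorm (a - b) ^+ 2 by rewrite sqr_ge0.
elim: k => [|k ih].
  rewrite !expr1 expr0 mulr1 mul1r subrr rnorm0.
  rewrite mulr_ge0// mulr_ge0 ?exprn_ge0 ?mulr_ge0 ?exprn_ge0 ?ler0n//.
have -> : a ^+ k.+2 - b ^+ k.+2 - k.+2%:R * b ^+ k.+1 * (a - b) =
   a * (a ^+ k.+1 - b ^+ k.+1 - k.+1%:R * b ^+ k * (a - b))
     + k.+1%:R * b ^+ k * (a - b) ^+ 2.
  rewrite -[k.+2%:R]natr1 !exprS; ring.
apply: le_trans (rnormD _ _) _; rewrite !rnormM !rnormX.
have nk : rnorm (k.+1%:R : C) = k.+1%:R.
  by rewrite -(rmorph_nat (@real_complex R)) rnormR ger0_norm.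
rewrite nk.
have h1 : rnorm a * rnorm (a ^+ k.+1 - b ^+ k.+1 - k.+1%:R * b ^+ k * (a - b)) <=
  rho * (4 * k.+1%:R ^+ 2 * rho ^+ k.+1 * rnorm (a - b) ^+ 2).
  by apply: ler_pM => //; exact: rnorm_ge0.
have h2 : k.+1%:R * rnorm b ^+ k * rnorm (a - b) ^+ 2 <=
    k.+1%:R * (4 * rho ^+ k.+2) * rnorm (a - b) ^+ 2.
  rewrite ler_wpM2r// ler_wpM2l// (le_trans (_ : _ <= rho ^+ k))//.
    by rewrite lerXn2r ?nnegrE ?rnorm_ge0.
  have : 0 <= rho ^+ k by rewrite exprn_ge0.
  rewrite !exprS; move: (rho ^+ k) => t t0.
  have : t * (1/4) <= t * (rho * rho) by rewrite ler_wpM2l//; nra.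
  lra.
apply: le_trans (lerD h1 h2) _.
rewrite -[k.+2%:R]natr1 (exprS rho k.+1) (exprS rho k).
have : 0 <= rho ^+ k by rewrite exprn_ge0.
move: (rho ^+ k) (k.+1%:R : R) (ler0n R k.+1) (rnorm _ ^+ 2) d20.
move=> t x x0 dd dd0 t0.
have h : 0 <= rho * rho * t * dd by rewrite !mulr_ge0.
have : 0 <= x * (rho * rho * t * dd) by rewrite mulr_ge0.
lra.
Qed.

(** rho^k = exp(- L k) with L = - ln rho > 0, and exp(L k) >= (L k)^3 / 6. *)
Lemma sq_geometric_lim (rho : R) : 0 < rho < 1 ->
  forall e, 0 < e -> exists K, forall k, (K <= k)%N -> k%:R ^+ 2 * rho ^+ k <= e.
Proof.
move=> /andP[r0 r1] e e0.
have L0 : 0 < - ln rho by rewrite oppr_gt0 ln_lt0// r0.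
set L := - ln rho in L0 *.
have L30 : 0 < L ^+ 3 by rewrite exprn_gt0.
exists (Num.Def.archi_bound (6 / (e * L ^+ 3))) => k kK.
have [->|k0] := posnP k; first by rewrite expr0n /= mul0r ltW.
have kk : 6 / (e * L ^+ 3) <= k%:R.
  apply: le_trans (ltW (archi_boundP _)) _; last by rewrite ler_nat.
  by rewrite divr_ge0// mulr_ge0// ltW.
have -> : rho ^+ k = (expR (L * k%:R))^-1.
  by rewrite -expRN -mulNr opprK mulrC expRM_natl lnK.
rewrite ler_pdivrMr ?expR_gt0//.
have Lk0 : 0 <= L * k%:R by rewrite mulr_ge0// ltW.
have := expR_ge1Dxn 2 Lk0; rewrite (_ : 3`! = 6)%N//.
move: kk; rewrite ler_pdivrMr ?mulr_gt0// exprMn.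
move: (L ^+ 3) L30 (k%:R : R) (ler0n R k) (expR _) => l l0 y y0 E h1 h2.
have h3 : e * (1 + l * y ^+ 3 / 6) <= e * E by rewrite ler_wpM2l// ltW.
have h4 : y ^+ 2 * 6 <= y ^+ 2 * (y * (e * l)) by rewrite ler_wpM2l// sqr_ge0.
rewrite !exprS expr0 in h3 h4 *; lra.
Qed.

Let q (z : C) : C := (1 + z) / 2.

Let rnorm_half (z : C) : rnorm (z / 2) = rnorm z / 2.
Proof.
rewrite rnormM rnormV; congr (_ / _).
by rewrite -(rmorph_nat (@real_complex R)) rnormR ger0_norm.
Qed.

Let rnorm_q_le (z : C) r : rnorm z <= r -> rnorm (q z) <= (1 + r) / 2.
Proof.
move=> zr; rewrite rnorm_half ler_wpM2r//.
by apply: le_trans (rnormD _ _) _; rewrite rnorm1 lerD2l.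
Qed.

(** Parallelogram law: |1 + z|^2 + |1 - z|^2 = 2 + 2 |z|^2 <= 4, whence
    |q z|^2 <= 1 - d^2 / 4. *)
Let rnorm_q_away (z : C) d : rnorm z <= 1 -> 0 <= d -> d <= rnorm (z - 1) -> d <= 1 ->
  rnorm (q z) <= 1 - d ^+ 2 / 8.
Proof.
move=> z1 d0 dz d1.
have d21 : d ^+ 2 <= 1 by rewrite expr_le1.
have h0 : 0 <= 1 - d ^+ 2 / 8 by lra.
rewrite -(ler_pXn2r (n := 2)) ?nnegrE ?rnorm_ge0// rnorm_half exprMn.
have : d ^+ 2 <= rnorm (z - 1) ^+ 2 by rewrite lerXn2r ?nnegrE ?rnorm_ge0.
have : rnorm z ^+ 2 <= 1 by rewrite expr_le1 ?rnorm_ge0.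
rewrite !rnorm_sqr; case: z {z1 dz} => x y /=.
have : 0 <= d ^+ 2 * d ^+ 2 by rewrite mulr_ge0 ?sqr_ge0.
move: (d ^+ 2) => D; rewrite !expr2; lra.
Qed.

Let jet_bound_qX r k : 0 <= r <= 1 ->
  jet_bound (fun z => q z ^+ k.+1) (fun z => k.+1%:R * q z ^+ k / 2) r
    (4 * (k.+1%:R ^+ 2 * ((1 + r) / 2) ^+ k.+1)).
Proof.
move=> /andP[r0 r1] z zr; set rho := (1 + r) / 2.
have rho2 : 1 / 2 <= rho by rewrite /rho; lra.
have rho0 : 0 <= rho by lra.
have rhok : 0 <= rho ^+ k by rewrite exprn_ge0.
have qz : rnorm (q z) <= rho by exact: rnorm_q_le.
have qX j : rnorm (q z) ^+ j <= rho ^+ j by rewrite lerXn2r ?nnegrE ?rnorm_ge0.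
have K1 : 1 <= k.+1%:R :> R by rewrite ler1n.
have K2 : k.+1%:R <= k.+1%:R ^+ 2 :> R by rewrite expr2 ler_peMr.
split.
- rewrite rnormX (le_trans (qX _))// mulrA ler_peMl ?exprn_ge0//; lra.
- rewrite rnorm_half rnormM rnormX.
  have -> : rnorm (k.+1%:R : C) = k.+1%:R.
    by rewrite -(rmorph_nat (@real_complex R)) rnormR ger0_norm.
  apply: (@le_trans _ _ (k.+1%:R * rho ^+ k / 2)).
    by rewrite ler_wpM2r// ler_wpM2l.
  rewrite (exprS rho); move: (k.+1%:R) (rho ^+ k) K1 K2 rhok => x t x1 x2 t0.
  have h1 : x * t <= x ^+ 2 * t by rewrite ler_wpM2r.
  have h2 : x ^+ 2 * t * (1 / 2) <= x ^+ 2 * t * rho.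
    by rewrite ler_wpM2l// mulr_ge0// sqr_ge0.
  have h0 : 0 <= x * t by rewrite mulr_ge0// (le_trans ler01).
  lra.
move=> w wr; have := expn_remainder k rho2 (rnorm_q_le wr) qz.
have -> : q w - q z = (w - z) / 2 by rewrite /q; field.
have -> : (w - z) *: (k.+1%:R * q z ^+ k / 2) = k.+1%:R * q z ^+ k * ((w - z) / 2).
  by rewrite /GRing.scale /=; ring.
rewrite rnorm_half => h; apply: le_trans h _; rewrite -[X in X * _]mulrA.
rewrite ler_wpM2l ?mulr_ge0 ?sqr_ge0 ?exprn_ge0//.
by rewrite lerXn2r ?nnegrE ?rnorm_ge0 ?divr_ge0 ?rnorm_ge0//;
  have := rnorm_ge0 (w - z); lra.
Qed.

(** The function ((1 + z) / 2)^k has modulus at most 1 on the closed disc, equals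
    1 at 1, and tends to 0 with k away from 1. It is multiplied by a fixed function
    T that vanishes on l and is 1 at 1; near 1 the factor T is close to 1, and
    elsewhere k large makes up for the size of T. *)
Lemma exists_peak (l : seq C) (r d e : R) :
  (forall x, x \in l -> x != 1) -> 0 <= r < 1 -> 0 < d -> 0 < e ->
  exists s s' : C -> C, [/\ s 1 = 1, forall x, x \in l -> s x = 0,
    jet_bound s s' r e, exists M, jet_bound s s' 1 M &
    (forall z : C, rnorm z <= 1 -> d <= rnorm (z - 1) -> rnorm (s z) <= e) /\
    (forall z : C, rnorm z <= 1 -> rnorm (s z) <= 1 + e)].
Proof.
move=> l1 /andP[r0 r1] d0 e0.
have [T [T' [M [T1 Tl jT]]]] := exists_interpolant l1.
have M1 : 1 <= M.
  by have [] := jT 1; rewrite ?rnorm1// T1 rnorm1.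
have M0 : 0 < M by lra.
(* [|T z| <= 1 + e] within distance [d'] of 1, as [T] is [3 * M]-Lipschitz *)
pose d' := Num.min (Num.min d 1) (e / (3 * M)).
have d'0 : 0 < d' by rewrite !lt_min d0 ltr01 divr_gt0// mulr_gt0.
have [d'd d'1 d'e] : [/\ d' <= d, d' <= 1 & d' <= e / (3 * M)].
  by rewrite /d'; split; rewrite !ge_min lexx ?orbT.
have d'2 : 0 < d' ^+ 2 <= 1 by rewrite exprn_gt0//= expr_le1// ltW.
have small rho : 0 < rho < 1 -> exists K, forall k, (K <= k)%N ->
    20 * M * (k.+1%:R ^+ 2 * rho ^+ k.+1) <= e.
  move=> rho01; have [|K KP] := sq_geometric_lim rho01 (_ : 0 < e / (20 * M)).
    by rewrite divr_gt0// mulr_gt0.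
  exists K => k Kk; have := KP k.+1 (leqW Kk).
  by rewrite ler_pdivlMr ?mulr_gt0// [leLHS]mulrC.
have [|K KP] := small ((1 + r) / 2); first by apply/andP; split; lra.
have [|K' K'P] := small (1 - d' ^+ 2 / 8).
  by case/andP: d'2 => ? ?; apply/andP; split; lra.
(* [K] makes the jets small on the disc of radius [r], [K'] makes the function
   small at distance [d'] from 1 *)
pose k := maxn K K'.
have KPk := KP k (leq_maxl _ _); have K'Pk := K'P k (leq_maxr _ _).
pose s (z : C) : C := T z * q z ^+ k.+1.
pose s' (z : C) : C := T z *: (k.+1%:R * q z ^+ k / 2) + T' z *: q z ^+ k.+1.
have jQ rr : 0 <= rr <= 1 -> jet_bound s s' rr
    (20 * M * (k.+1%:R ^+ 2 * ((1 + rr) / 2) ^+ k.+1)).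
  move=> rr01; case/andP: (rr01) => _ rr1.
  apply: jet_bound_le (lexx _) _
    (jet_boundZ rr1 (jet_bound_le rr1 (lexx _) jT) (jet_bound_qX k rr01)).
  by rewrite le_eqVlt; apply/orP; left; apply/eqP; ring.
exists s, s'; split.
- by rewrite /s T1 mul1r /q (_ : 1 + 1 = 2) ?divff ?expr1n//; apply: (@lt0r_neq0).
- by move=> x /Tl; rewrite /s => ->; rewrite mul0r.
- by apply: jet_bound_le (lexx _) KPk (jQ r _); rewrite r0 ltW.
- by eexists; apply: (jQ 1); rewrite ler01 lexx.
have away (z : C) : rnorm z <= 1 -> d' <= rnorm (z - 1) -> rnorm (s z) <= e.
  move=> z1 dz; apply: le_trans K'Pk; rewrite /s rnormM rnormX.
  have [h1 _ _] := jT z z1.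
  have h2 : rnorm (q z) ^+ k.+1 <= (1 - d' ^+ 2 / 8) ^+ k.+1.
    rewrite lerXn2r ?nnegrE ?rnorm_ge0//; first by case/andP: d'2 => ? ?; lra.
    by rewrite rnorm_q_away// ltW.
  apply: (le_trans (ler_pM _ _ h1 h2)); rewrite ?exprn_ge0 ?rnorm_ge0//.
  set X := (1 - _) ^+ _ in h2 *.
  have X0 : 0 <= X by apply: le_trans h2; rewrite exprn_ge0 ?rnorm_ge0.
  have : 1 * X <= k.+1%:R ^+ 2 * X by rewrite ler_wpM2r// exprn_ege1// ler1n.
  rewrite mul1r; set Y := _ * X => XY.
  have : M * X <= M * Y by rewrite ler_wpM2l// ltW.
  have : 0 <= M * X by rewrite mulr_ge0// ltW.
  lra.
split=> z z1; first by move=> dz; apply: away => //; exact: le_trans dz.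
have [dz|zd] := lerP d' (rnorm (z - 1)); first by have := away z z1 dz; lra.
rewrite /s rnormM rnormX.
have [h1 _ _] := jT z z1.
have h2 : rnorm (q z) ^+ k.+1 <= 1.
  by rewrite exprn_ile1 ?rnorm_ge0//; have := rnorm_q_le z1; lra.
apply: (le_trans (ler_wpM2l _ h2)); rewrite ?rnorm_ge0// mulr1.
have := jet_bound_lip (lexx _) jT (_ : rnorm (1 : C) <= 1) z1.
rewrite rnorm1 T1 => /(_ (lexx _)) h3.
have := rnormD (T z - 1) 1; rewrite subrK rnorm1.
have : 3 * M * rnorm (z - 1) <= e.
  by rewrite mulrC -ler_pdivlMr ?mulr_gt0// (le_trans (ltW zd)).
lra.
Qed.

End Jets.

(** * Moving the boundary value of a disc inside a domain *)

Section Adjust.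
Context {R : realType} {V : normedModType R[i]}.
Local Notation C := R[i].
Implicit Types (D : set V) (f g h : C -> V) (l : seq C).

Let rnorm1_le : rnorm (1 : C) <= 1. Proof. by rewrite rnorm1. Qed.

Definition margin D f (e : R) :=
  forall z, rnorm z <= 1 -> forall y, rnorm (y - f z) < e -> D y.

Definition continuous_at_one f := forall e : R, 0 < e ->
  exists d : R, 0 < d /\ forall z : C, rnorm z <= 1 -> rnorm (z - 1) < d ->
    rnorm (f z - f 1) < e.

(** Only the point 1 of the unit circle is ever used, so this is the only one
    where continuity is recorded; away from it the margin does the work of
    compactness. *)
Definition disc_in D f := [/\ exists e, 0 < e /\ margin D f e,
  continuous_at_one f & forall z, rnorm z < 1 -> exists f'z, has_cderiv f z f'z].

(** Formulated for the pair f, g rather than for the correction g - f, so that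
    successive adjustments compose with their errors adding up. *)
Definition adjusts D l (r e : R) f g := [/\ disc_in D g,
  forall x, x \in l -> g x = f x &
  exists s', jet_bound (fun z => g z - f z) s' r e].

Lemma adjusts_trans D l r e e' f g h : adjusts D l r e f g ->
  adjusts D l r e' g h -> adjusts D l r (e + e') f h.
Proof.
move=> [_ fg [s' js]] [Dh gh [t' jt]]; split=> //.
  by move=> x xl; rewrite gh// fg.
exists (fun z => s' z + t' z).
have -> : (fun z => h z - f z) = (fun z => (g z - f z) + (h z - g z)).
  by apply: funext => z; rewrite [RHS]addrC subrKA.
exact: jet_boundD.
Qed.

Lemma disc_in_add D f (s s' : C -> V) M : disc_in D f -> jet_bound s s' 1 M ->
  (exists e, 0 < e /\ margin D (fun z => f z + s z) e) ->
  disc_in D (fun z => f z + s z).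
Proof.
move=> [_ cf df] js mg; split=> //.
  move=> e e0; have e20 : 0 < e / 2 by rewrite divr_gt0.
  have [d [d0 dP]] := cf _ e20.
  have M0 : 0 <= M.
    by have [h _ _] := js 1 rnorm1_le; apply: le_trans h; exact: rnorm_ge0.
  have M1 : 0 < 3 * M + 1 by lra.
  exists (Num.min d (e / 2 / (3 * M + 1))); split.
    by rewrite lt_min d0 divr_gt0.
  move=> z z1; rewrite lt_min => /andP[/(dP _ z1) h]; rewrite ltr_pdivlMr// => h'.
  have := jet_bound_lip (lexx 1) js rnorm1_le z1.
  have -> : f z + s z - (f 1 + s 1) = (f z - f 1) + (s z - s 1).
    by rewrite opprD addrACA.
  have := rnormD (f z - f 1) (s z - s 1); have := rnorm_ge0 (z - 1); lra.
move=> z z1; have [m fm] := df z z1; exists (m + s' z).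
exact: has_cderivD fm (jet_bound_has_cderiv js z1).
Qed.

(** Add s v, with s a peak function at 1. Near 1, f z is close to f 1 and |s z v|
    is almost at most |v|, so the value stays in the ball of radius rho about f 1;
    away from 1, |s z v| is less than the margin of f. *)
Lemma adjust_push D l r e f v rho : disc_in D f -> (forall x, x \in l -> x != 1) ->
  0 <= r < 1 -> 0 < e -> (forall y, rnorm (y - f 1) < rho -> D y) ->
  rnorm v < rho -> exists g, adjusts D l r e f g /\ g 1 = f 1 + v.
Proof.
move=> Df l1 r01 e0 brho vrho; have [[e1 [e10 mf]] cf _] := Df.
have v0 := rnorm_ge0 v.
have [eta eta0 etaE] : exists2 eta, 0 < eta & 4 * eta = rho - rnorm v.
  by exists ((rho - rnorm v) / 4); lra.
have [d [d0 dP]] := cf _ eta0.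
(* [m] bounds the size of [s z *: v] away from 1; the factor 5 is the constant
   of [jet_boundZ] *)
have [m [m0 me m1 meta]] : exists m, [/\ 0 < m, 5 * m <= e, 2 * m <= e1 & m <= eta].
  exists (Num.min (Num.min (e / 5) (e1 / 2)) eta); split.
  - by rewrite !lt_min eta0 !divr_gt0.
  - by rewrite mulrC -ler_pdivlMr// !ge_min lexx.
  - by rewrite mulrC -ler_pdivlMr// !ge_min lexx orbT.
  - by rewrite ge_min lexx orbT.
have v1 : 0 < rnorm v + 1 by lra.
have [s [s' [s1 sl js [M jM] [away near]]]] :=
  exists_peak l1 r01 d0 (divr_gt0 m0 v1).
set ep := m / (rnorm v + 1) in js away near.
have ep0 : 0 < ep by rewrite divr_gt0.
have epv : ep * rnorm v <= m.
  by rewrite /ep mulrAC ler_pdivrMr// ler_wpM2l ?ltW//; lra.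
have jZ rr MM : rr <= 1 -> jet_bound s s' rr MM ->
    jet_bound (fun z => s z *: v) (fun z => s z *: 0 + s' z *: v) rr (5 * MM * rnorm v).
  by move=> r1 j; exact: (jet_boundZ r1 j (@jet_bound_cst _ _ v rr)).
have [r1 r0] : r <= 1 /\ 0 <= r by case/andP: r01 => ? /ltW.
exists (fun z => f z + s z *: v); split; last by rewrite s1 scale1r.
split.
- apply: (disc_in_add Df (jZ _ _ (lexx _) jM)).
  exists (Num.min eta (e1 / 2)); split; first by rewrite lt_min eta0 divr_gt0.
  move=> z z1 y; rewrite lt_min => /andP[y1 y2].
  have [zd|dz] := ltP (rnorm (z - 1)) d.
    apply: brho; have h1 := dP z z1 zd.
    have h2 : rnorm (s z *: v) <= rnorm v + m.
      rewrite rnormZ; apply: le_trans (ler_wpM2r v0 (near z z1)) _; lra.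
    have -> : y - f 1 = (y - (f z + s z *: v)) + ((f z - f 1) + s z *: v).
      by rewrite [f z - f 1 + _]addrAC addrA subrK.
    have := rnormD (y - (f z + s z *: v)) ((f z - f 1) + s z *: v).
    have := rnormD (f z - f 1) (s z *: v); lra.
  apply: (mf z z1); have h2 : rnorm (s z *: v) <= m.
    by rewrite rnormZ; apply: le_trans (ler_wpM2r v0 (away z z1 dz)) _.
  have -> : y - f z = (y - (f z + s z *: v)) + s z *: v.
    by rewrite opprD addrA subrK.
  have := rnormD (y - (f z + s z *: v)) (s z *: v); lra.
- by move=> x /sl ->; rewrite scale0r addr0.
exists (fun z => s z *: 0 + s' z *: v).
rewrite [X in jet_bound X](_ : _ = fun z => s z *: v); last first.
  by apply: funext => z; rewrite addrC addKr.
by apply: jet_bound_le (lexx _) _ (jZ _ _ r1 js); rewrite -mulrA; lra.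
Qed.

(** The set A of the values that can be given to the disc at 1 by arbitrarily
    small corrections contains f 1. By [adjust_push], a point of A has with it
    every ball of D about it, and a point of D that is close to A lies in A; so A
    is open and closed in the connected set D. *)
Lemma adjust_reach D l r e f b : open D -> connected D -> disc_in D f ->
  (forall x, x \in l -> x != 1) -> 0 <= r < 1 -> 0 < e -> D b ->
  exists g, adjusts D l r e f g /\ g 1 = b.
Proof.
move=> oD cD Df l1 r01 e0 Db.
pose A : set V := [set b | D b /\
  forall e, 0 < e -> exists g, adjusts D l r e f g /\ g 1 = b].
suff AD : A = D by have [_ /(_ e e0)] : A b by rewrite AD.
have ball_in y : D y -> exists rho : R, 0 < rho /\ forall x, rnorm (x - y) < rho -> D x.
  by move=> Dy; apply/nbhs_rnormP; exact: open_nbhs_nbhs.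
have step y x rho : (forall x, rnorm (x - y) < rho -> D x) -> A y ->
    rnorm (x - y) < rho -> A x.
  move=> brho [Dy Ay] xy; split; first exact: brho.
  move=> d d0; have d20 : 0 < d / 2 by rewrite divr_gt0.
  have [g [fg g1]] := Ay _ d20.
  have [Dg _ _] := fg.
  have [h [gh h1]] := @adjust_push D l r (d / 2) g (x - y) rho Dg l1 r01 d20
    (fun z => eq_rect_r (fun u => rnorm (z - u) < rho -> D z) (brho z) g1) xy.
  exists h; split; last by rewrite h1 g1 addrC subrK.
  by have := adjusts_trans fg gh; rewrite -splitr.
have f1 : D (f 1).
  have [[e1 [e10 mf]] _ _] := Df; apply: (mf 1 rnorm1_le).
  by rewrite subrr rnorm0.
have Af1 : A (f 1).
  split=> // d d0; exists f; split=> //; split=> //.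
  exists (fun=> 0); apply: jet_bound_le (lexx _) (ltW d0) _.
  rewrite [X in jet_bound X](_ : _ = fun=> 0).
    by have := @jet_bound_cst _ _ (0 : V) r; rewrite rnorm0.
  by apply: funext => z; rewrite subrr.
have oA : open A.
  rewrite openE => y Ay; have [rho [rho0 brho]] := ball_in y Ay.1.
  by apply/nbhs_rnormP; exists rho; split=> // x; exact: step Ay.
have oDA : open (D `\` A).
  rewrite openE => y [Dy nAy]; have [rho [rho0 brho]] := ball_in y Dy.
  apply/nbhs_rnormP; exists (rho / 2); split; first by rewrite divr_gt0.
  move=> x xy; split; first by apply: brho; lra.
  move=> Ax; apply: nAy; apply: (step x y (rho / 2)) => //.
    by move=> z zx; apply: brho; have := rnorm_distD x z y; lra.
  by rewrite rnorm_distC.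
apply: cD; first by exists (f 1).
  by exists A => //; rewrite setIC; apply/esym/setIidPl => x [].
exists (~` (D `\` A)); first exact: open_closedC.
apply/seteqP; split=> x; first by move=> Ax; split; [case: Ax | case].
by move=> [Dx nx]; apply: contrapT => nAx; exact: nx.
Qed.

(** First make the value at 1 equal to b. By continuity the value at t < 1 close
    to 1 is nearly b, and a multiple of the interpolating function T, small
    because T t is close to 1, makes it exactly b. *)
Lemma adjust_hit D l r e f b : open D -> connected D -> disc_in D f ->
  (forall x, x \in l -> x != 1) -> 0 <= r < 1 -> 0 < e -> D b ->
  exists g mu, [/\ adjusts D l r e f g, rnorm mu < 1 & g mu = b].
Proof.
move=> oD cD Df l1 r01 e0 Db; have e20 : 0 < e / 2 by rewrite divr_gt0.
have [g [fg g1]] := adjust_reach oD cD Df l1 r01 e20 Db.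
have [Dg _ _] := fg; have [[e1 [e10 mg]] cg _] := Dg.
have [T [T' [M [T1 Tl jT]]]] := exists_interpolant l1.
have M1 : 1 <= M by have [] := jT 1; rewrite ?rnorm1// T1 rnorm1.
have [m [m0 me me1]] : exists m, [/\ 0 < m, 10 * M * m <= e / 2 & 4 * M * m <= e1].
  exists (Num.min (e / 2 / (10 * M)) (e1 / (4 * M))); split.
  - by rewrite lt_min !divr_gt0// mulr_gt0//; lra.
  - by rewrite mulrC -ler_pdivlMr ?ge_min ?lexx// mulr_gt0//; lra.
  - by rewrite mulrC -ler_pdivlMr ?ge_min ?lexx ?orbT// mulr_gt0//; lra.
have [d [d0 dP]] := cg _ m0.
(* close enough to 1 for [|T t|] to be at least 1/2 *)
have [t [t0 t1 td tM]] : exists t : R, [/\ 0 <= t, t < 1, 1 - t < d & 3 * M * (1 - t) <= 1 / 2].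
  exists (1 - Num.min (d / 2) (1 / (6 * M))).
  have : 0 < Num.min (d / 2) (1 / (6 * M)).
    by rewrite lt_min !divr_gt0// mulr_gt0//; lra.
  have : Num.min (d / 2) (1 / (6 * M)) <= d / 2 by rewrite ge_min lexx.
  have : Num.min (d / 2) (1 / (6 * M)) <= 1 / (6 * M) by rewrite ge_min lexx orbT.
  rewrite ler_pdivlMr ?mulr_gt0//; last lra.
  move: (Num.min _ _) => x x1 x2 x0.
  have : x * 1 <= x * M by rewrite ler_wpM2l// ltW.
  by split; lra.
have tn : rnorm t%:C <= 1 by rewrite rnormR ger0_norm// ltW.
have t1n : rnorm (t%:C - 1) = 1 - t.
  by rewrite -[1]/(1%:C) -rmorphB rnormR distrC ger0_norm//; lra.
have bgt : rnorm (b - g t%:C) <= m.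
  by rewrite -g1 rnorm_distC ltW// dP// t1n.
have Tt : 1 / 2 <= rnorm (T t%:C).
  have := jet_bound_lip (lexx 1) jT rnorm1_le tn; rewrite t1n T1 => h.
  have := rnormD (1 - T t%:C) (T t%:C); rewrite subrK rnorm1 rnorm_distC; lra.
have Tt0 : T t%:C != 0.
  by apply/eqP => h; move: Tt; rewrite h rnorm0; lra.
pose v := (T t%:C)^-1 *: (b - g t%:C).
have vm : rnorm v <= 2 * m.
  rewrite rnormZ rnormV; apply: ler_pM; rewrite ?invr_ge0 ?rnorm_ge0//.
  by rewrite invf_ple ?posrE//; lra.
have jZ : jet_bound (fun z => T z *: v) (fun z => T z *: 0 + T' z *: v) 1 (5 * M * rnorm v).
  exact: (jet_boundZ (lexx _) jT (@jet_bound_cst _ _ v 1)).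
have Mv : M * rnorm v <= M * (2 * m) by rewrite ler_wpM2l//; lra.
exists (fun z => g z + T z *: v), t%:C; split; last first.
- by rewrite scalerA mulfV// scale1r addrC subrK.
- by rewrite rnormR ger0_norm.
rewrite [e]splitr; apply: adjusts_trans fg _; split.
- apply: disc_in_add Dg jZ _; exists (e1 / 2); split; first by rewrite divr_gt0.
  move=> z z1 y yz; apply: (mg z z1).
  have -> : y - g z = (y - (g z + T z *: v)) + T z *: v.
    by rewrite opprD addrA subrK.
  have := rnormD (y - (g z + T z *: v)) (T z *: v).
  have : rnorm (T z *: v) <= M * rnorm v.
    by rewrite rnormZ ler_wpM2r ?rnorm_ge0//; have [] := jT z z1.
  lra.
- by move=> x /Tl ->; rewrite scale0r addr0.
exists (fun z => T z *: 0 + T' z *: v).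
rewrite [X in jet_bound X](_ : _ = fun z => T z *: v); last first.
  by apply: funext => z; rewrite addrC addKr.
apply: jet_bound_le _ _ jZ; first by case/andP: r01 => _ /ltW.
lra.
Qed.

End Adjust.

(** * A disc through a sequence of points *)

Section Limit.
Context {R : realType} {n : nat}.
Local Notation C := R[i].
Local Notation V := 'rV[C]_n.

Let remainder_split (W : normedModType C) (d : C) (F1 F2 f1 f2 g1 g2 G S T : W) :
  F1 - f1 - (F2 - f2) - d *: (G - S) =
  (g1 - f1 - (g2 - f2) - d *: (T - S)) + ((F1 - g1) + ((g2 - F2) + d *: (T - G))).
Proof.
rewrite -[g2 - F2]opprB -[T - G]opprB scalerN.
rewrite -(subrKA g1 F1 (- f1)) -(subrKA g2 F2 (- f2)) -(subrKA T G (- S)) scalerDr.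
rewrite !opprD (addrACA (F1 - g1)) [LHS]addrACA [LHS]addrC; congr (_ + _).
by rewrite -addrA.
Qed.

(** The functions f j - f k with j >= k have jets bounded by e k on the disc of
    radius r k, and these bounds pass to the pointwise limit. So F = f k + (F - f k)
    is differentiable on that disc. *)
Lemma limit_disc (f : nat -> C -> V) (r e : nat -> R) :
  (forall k, 0 <= e k) -> (forall k, e k.+1 <= e k / 2) ->
  (forall k, r k <= 1) -> (forall j k, (j <= k)%N -> r j <= r k) ->
  (forall z : C, rnorm z < 1 -> exists k, rnorm z < r k) ->
  (forall k z, rnorm z < 1 -> exists f'z, has_cderiv (f k) z f'z) ->
  (forall k, exists s', jet_bound (fun z => f k.+1 z - f k z) s' (r k) (e k / 2)) ->
  exists F : C -> V,
    (forall z, rnorm z < 1 -> exists F'z, has_cderiv F z F'z) /\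
    (forall k z, rnorm z <= r k -> rnorm (F z - f k z) <= e k).
Proof.
move=> e0 eS r1 rle rlim df /choice[s' js].
pose S k z := \sum_(j < k) s' j z.
have /choice[F FP] z := rapid_lim (fun k => f k z) e0 eS.
have /choice[G GP] z := rapid_lim (fun k => S k z) e0 eS.
have Fe k z : rnorm z <= r k -> rnorm (F z - f k z) <= e k.
  move=> zr; apply: FP => j kj.
  by have [] := js j z (le_trans zr (rle _ _ kj)).
have Ge k z : rnorm z <= r k -> rnorm (G z - S k z) <= e k.
  move=> zr; apply: GP => j kj; rewrite /S big_ord_recr/= addrAC subrr add0r.
  by have [] := js j z (le_trans zr (rle _ _ kj)).
have jS k j : jet_bound (fun z => f (k + j)%N z - f k z)
    (fun z => S (k + j)%N z - S k z) (r k) (e k - e (k + j)%N).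
  elim: j => [|j ih].
    rewrite addn0 subrr => z _; rewrite !subrr rnorm0; split=> // w _.
    by rewrite !subrr scaler0 subr0 rnorm0 mul0r.
  have jj := jet_bound_le (rle _ _ (leq_addr j k)) (lexx _) (js (k + j)%N).
  rewrite addnS.
  have -> : (fun z => f (k + j).+1 z - f k z) =
      (fun z => (f (k + j)%N z - f k z) + (f (k + j).+1 z - f (k + j)%N z)).
    by apply: funext => z; rewrite [RHS]addrC subrKA.
  have -> : (fun z => S (k + j).+1 z - S k z) =
      (fun z => (S (k + j)%N z - S k z) + s' (k + j)%N z).
    by apply: funext => z; rewrite /S big_ord_recr/= addrAC.
  apply: jet_bound_le (lexx _) _ (jet_boundD ih jj).
  by have := eS (k + j)%N; lra.
have jF k : jet_bound (fun z => F z - f k z) (fun z => G z - S k z) (r k) (e k).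
  move=> z zr; split; [exact: Fe | exact: Ge | move=> w wr].
  apply/ler_addgt0Pr => d d0.
  have [K KP] := halving_bound e0 eS (divr_gt0 d0 (ltr0n _ 4)).
  have := KP (k + K)%N (leq_addl _ _).
  have [_ _ /(_ w wr)] := jS k K z zr.
  have rk := rle _ _ (leq_addr K k).
  have := Fe (k + K)%N z (le_trans zr rk).
  have := Fe (k + K)%N w (le_trans wr rk).
  have := Ge (k + K)%N z (le_trans zr rk).
  set fK := f (k + K)%N; set SK := S (k + K)%N; set eK := e (k + K)%N.
  move=> h1 h2 h3 h4 h5.
  have dist := disc_dist_le2 (r1 k) zr wr.
  have -> : F w - f k w - (F z - f k z) - (w - z) *: (G z - S k z) =
    (fK w - f k w - (fK z - f k z) - (w - z) *: (SK z - S k z)) +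
    ((F w - fK w) + ((fK z - F z) + (w - z) *: (SK z - G z))).
    exact: remainder_split.
  have t1 := rnormD (fK w - f k w - (fK z - f k z) - (w - z) *: (SK z - S k z))
    ((F w - fK w) + ((fK z - F z) + (w - z) *: (SK z - G z))).
  have t2 := rnormD (F w - fK w) ((fK z - F z) + (w - z) *: (SK z - G z)).
  have t3 := rnormD (fK z - F z) ((w - z) *: (SK z - G z)).
  have t4 : rnorm ((w - z) *: (SK z - G z)) <= 2 * eK.
    by rewrite rnormZ; apply: ler_pM; rewrite ?rnorm_ge0// rnorm_distC.
  have t5 : (e k - eK) * rnorm (w - z) ^+ 2 <= e k * rnorm (w - z) ^+ 2.
    by rewrite ler_wpM2r ?sqr_ge0// gerBl; exact: e0.
  rewrite rnorm_distC in h3; lra.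
exists F; split=> // z z1; have [k zk] := rlim z z1.
have [f'z fz] := df k z z1; exists (f'z + (G z - S k z)).
have -> : F = (fun z => f k z + (F z - f k z)).
  by apply: funext => w; rewrite addrC subrK.
exact: has_cderivD fz (jet_bound_has_cderiv (jF k) zk).
Qed.

(** A disc, the points where its values are final, and the room e for all the
    later corrections together: they are at most e / 2, e / 4, and so on. *)
Record stage := Stage { disc_map : C -> V; nodes : seq C; slack : R }.

(** The later corrections move a value by at most slack, half the margin, so the
    limit stays in D. *)
Definition admissible (D : set V) st := [/\ disc_in D (disc_map st),
  forall x, x \in nodes st -> rnorm x < 1, 0 < slack st &
  margin D (disc_map st) (2 * slack st)].

Definition extends (r : R) (b : V) st st' := [/\
  exists2 mu, mu \in nodes st' & disc_map st' mu = b,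
  forall x, x \in nodes st -> x \in nodes st' /\ disc_map st' x = disc_map st x,
  exists s', jet_bound (fun z => disc_map st' z - disc_map st z) s' r (slack st / 2) &
  slack st' <= slack st / 2].

Lemma exists_extension (D : set V) r b st : open D -> connected D -> D b ->
  0 <= r < 1 -> admissible D st ->
  exists st', admissible D st' /\ extends r b st st'.
Proof.
move=> oD cD Db r01; case: st => f l e [/= Df l1 e0 mf].
have lN x : x \in l -> x != 1.
  by move=> /l1; apply: contraTneq => ->; rewrite rnorm1 ltxx.
have [g [mu [[Dg gl js] mu1 gmu]]] := adjust_hit oD cD Df lN r01 (divr_gt0 e0 (ltr0n _ 2)) Db.
have [[e1 [e10 mg]] _ _] := Dg.
exists (Stage g (mu :: l) (Num.min (e / 2) (e1 / 2))); split; split=> //=.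
- by move=> x; rewrite inE => /orP[/eqP->|/l1].
- by rewrite lt_min !divr_gt0.
- move=> z z1 y yz; apply: (mg z z1); apply: lt_le_trans yz _.
  by rewrite mulrC -ler_pdivlMr// ge_min lexx orbT.
- by exists mu; rewrite ?inE ?eqxx.
- by move=> x xl; rewrite inE xl orbT gl.
- by rewrite ge_min lexx.
Qed.

(** Iterate [exists_extension] along a, with radii r k tending to 1. *)
Lemma disc_through (D : set V) (f : C -> V) (l : seq C) (a : nat -> V) :
  open D -> connected D -> disc_in D f -> (forall x, x \in l -> rnorm x < 1) ->
  (forall k, D (a k)) ->
  exists F, [/\ holomorphic_disc D F, forall x, x \in l -> F x = f x &
    forall k, exists2 mu, unit_disc mu & F mu = a k].
Proof.
move=> oD cD Df l1 Da.
pose r k : R := 1 - k.+1%:R^-1.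
have r01 k : 0 <= r k < 1.
  rewrite /r subr_ge0 invf_le1 ?ltr0n// ler1n /=.
  by rewrite gtrBl invr_gt0 ltr0n.
have rle j k : (j <= k)%N -> r j <= r k.
  by move=> jk; rewrite /r lerB// lef_pV2 ?posrE ?ltr0n// ler_nat ltnS.
have rlim (z : C) : rnorm z < 1 -> exists k, rnorm z < r k.
  move=> z1; exists (Num.Def.archi_bound (1 - rnorm z)^-1); rewrite /r.
  set k := Num.Def.archi_bound _.
  have h : 0 < 1 - rnorm z by rewrite subr_gt0.
  have : (1 - rnorm z)^-1 < k.+1%:R.
    have /archi_boundP : 0 <= (1 - rnorm z)^-1 by rewrite invr_ge0 ltW.
    by move=> /lt_le_trans; apply; rewrite ler_nat.
  rewrite -ltf_pV2 ?posrE ?invr_gt0 ?ltr0n// invrK => h2.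
  by rewrite ltrBrDr addrC -ltrBrDr.
have /choice[next nextP] (u : nat * stage) : exists st',
    admissible D u.2 -> admissible D st' /\ extends (r u.1) (a u.1) u.2 st'.
  have [adm|nadm] := pselect (admissible D u.2); last by exists u.2.
  by have [st' st'P] := exists_extension oD cD (Da u.1) (r01 u.1) adm; exists st'.
have [[e0 [e00 mf]] _ _] := Df.
pose st := fix st k := if k is j.+1 then next (j, st j) else Stage f l (e0 / 2).
have adm k : admissible D (st k).
  elim: k => [|k ih] /=; last by have [] := nextP (k, st k) ih.
  split=> //=; first by rewrite divr_gt0.
  by rewrite mulrC divfK.
have ext k : extends (r k) (a k) (st k) (st k.+1) by have [] := nextP (k, st k) (adm k).
have sl0 k : 0 < slack (st k) by case: (adm k).
have slS k : slack (st k.+1) <= slack (st k) / 2 by case: (ext k).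
have r1 k : r k <= 1 by case/andP: (r01 k) => _ /ltW.
have [||F [dF Fe]] := @limit_disc (fun k => disc_map (st k)) r (fun k => slack (st k))
    (fun k => ltW (sl0 k)) slS r1 rle rlim.
- by move=> k; case: (adm k) => -[].
- by move=> k; case: (ext k).
have stable k x : x \in nodes (st k) -> F x = disc_map (st k) x.
  move=> xk; have x1 : rnorm x < 1 by case: (adm k) => _ /(_ x xk).
  have later j : x \in nodes (st (k + j)%N) /\ disc_map (st (k + j)%N) x = disc_map (st k) x.
    elim: j => [|j [ih1 ih2]]; first by rewrite addn0.
    by rewrite addnS; case: (ext (k + j)%N) => _ /(_ x ih1)[? ->].
  apply/eqP; rewrite -subr_eq0; apply/eqP; apply: rnorm0_eq0.
  apply/ler_addgt0Pr => d d0; rewrite add0r.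
  have [i xi] := rlim x x1.
  have [K KP] := halving_bound (fun k => ltW (sl0 k)) slS d0.
  have [_ <-] := later (maxn i K).
  apply: le_trans (KP (k + maxn i K)%N _); last first.
    exact: leq_trans (leq_maxr _ _) (leq_addl _ _).
  apply: Fe; apply: le_trans (ltW xi) (rle _ _ _).
  exact: leq_trans (leq_maxl _ _) (leq_addl _ _).
exists F; split.
- split=> z /unit_disc_rnorm z1; last exact/derivable_has_cderiv/dF.
  have [k zk] := rlim z z1; case: (adm k) => _ _ _ mg.
  by apply: (mg z (ltW z1)); apply: le_lt_trans (Fe k z (ltW zk)) _; have := sl0 k; lra.
- by move=> x xl; rewrite (stable 0%N).
move=> k; have [[mu mul mua] _ _ _] := ext k.
exists mu; last by rewrite (stable k.+1).
by apply/unit_disc_rnorm; case: (adm k.+1) => _ /(_ mu mul).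
Qed.

End Limit.

(** * Discs through all the poles *)

Section Dilation.
Context {R : realType} {n : nat}.
Local Notation C := R[i].
Local Notation V := 'rV[C]_n.

(** The dilation maps the closed unit disc to a compact subset of the open disc,
    which gives the margin and the continuity at 1. *)
Lemma disc_in_dilation (D : set V) (psi : C -> V) (r : R) : open D ->
  holomorphic_disc D psi -> 0 < r < 1 -> disc_in D (fun z => psi (r%:C * z)).
Proof.
move=> oD [psiD dpsi] /andP[r0 r1].
have der z : rnorm z < 1 -> exists f'z, has_cderiv psi z f'z.
  by move=> /unit_disc_rnorm/dpsi/derivable_has_cderiv.
have rn (z : C) : rnorm (r%:C * z) = r * rnorm z.
  by rewrite rnormM rnormR gtr0_norm.
split.
- pose Q e (z : C) := forall y, rnorm (y - psi z) < e -> D y.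
  have [||e [e0 eQ]] := @disc_uniform R r Q.
  + by move=> e e' z _ e'e Qe y ye'; apply: Qe; exact: lt_le_trans e'e.
  + move=> z zr; have z1 := le_lt_trans zr r1.
    have /nbhs_rnormP[rho [rho0 brho]] : nbhs (psi z) D.
      by apply: open_nbhs_nbhs; split=> //; apply: psiD; apply/unit_disc_rnorm.
    have [f'z fz] := der z z1; have rho20 : 0 < rho / 2 by rewrite divr_gt0.
    have [d [d0 dP]] := has_cderiv_cont fz rho20.
    exists (rho / 2), d; split=> // w wz _ y yw; apply: brho.
    by have := dP w wz; have := rnorm_distD (psi w) y (psi z); lra.
  exists e; split=> // z z1; apply: eQ.
  by rewrite rn ler_piMr// ltW.
- have [f'r fr] : exists f'z, has_cderiv psi (r%:C * 1) f'z.
    by apply: der; rewrite rn rnorm1 mulr1.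
  move=> e e0; have [d [d0 dP]] := has_cderiv_cont fr e0.
  exists d; split=> // z _ z1; apply: dP.
  rewrite -mulrBr rn; apply: le_lt_trans z1.
  by rewrite ler_piMl ?rnorm_ge0// ltW.
move=> z z1; have [f'z fz] : exists f'z, has_cderiv psi (r%:C * z) f'z.
  apply: der; rewrite rn; apply: le_lt_trans z1.
  by rewrite ler_piMl ?rnorm_ge0// ltW.
exists (r%:C *: f'z) => e e0; have [d [d0 dP]] := fz e e0.
exists d; split=> // w wz.
have rwz : rnorm (r%:C * w - r%:C * z) <= rnorm (w - z).
  by rewrite -mulrBr rn ler_piMl ?rnorm_ge0// ltW.
have := dP (r%:C * w) (le_lt_trans rwz wz).
rewrite scalerA [(w - z) * _]mulrC mulrBr => h; apply: le_trans h _.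
by rewrite ler_wpM2l// ltW.
Qed.

End Dilation.

Section Products.
Context {R : realType}.

Lemma lt1_gap (T : eqType) (s : seq T) (c : T -> R) :
  (forall a, a \in s -> c a < 1) ->
  exists r, 0 < r < 1 /\ forall a, a \in s -> c a < r.
Proof.
elim: s => [_|x s ih cs]; first by exists (1 / 2); split=> //; apply/andP; split; lra.
have [|r [/andP[r0 r1] rs]] := ih.
  by move=> a sa; apply: cs; rewrite inE sa orbT.
have cx : c x < 1 by apply: cs; rewrite inE eqxx.
exists (Num.max r ((c x + 1) / 2)); split.
  by rewrite lt_max r0/= gt_max r1/=; lra.
move=> a; rewrite inE => /orP[/eqP->|/rs h]; rewrite lt_max; last by rewrite h.
by apply/orP; right; lra.
Qed.

Lemma prod_le_exprn (T : eqType) (s : seq T) (c : T -> R) (q : R) :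
  (forall a, a \in s -> 0 <= c a <= q) -> \prod_(a <- s) c a <= q ^+ size s.
Proof.
elim: s => [_|x s ih cs]; first by rewrite big_nil.
have /andP[c0 cq] : 0 <= c x <= q by apply: cs; rewrite inE eqxx.
have cs' a : a \in s -> 0 <= c a <= q by move=> sa; apply: cs; rewrite inE sa orbT.
rewrite big_cons exprS ler_pM ?ih//.
by rewrite big_seq; apply: prodr_ge0 => a /cs'/andP[].
Qed.

Lemma powR_dilate (c p t : R) : 0 <= c ->
  (c * expR t) `^ p = c `^ p * expR (p * t).
Proof.
move=> c0; rewrite powRM ?expR_ge0//; congr (_ * _).
by rewrite /powR gt_eqF ?expR_gt0// expRK.
Qed.

(** With r = exp(- t) the product is multiplied by exp(t S), S the sum of the
    exponents, which tends to 1 with t. *)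
Lemma exists_dilation (T : choiceType) (F : {fset T}) (c p : T -> R) (e : R) :
  (forall a, a \in F -> 0 <= c a < 1) -> (forall a, a \in F -> 0 <= p a) -> 0 < e ->
  exists r, [/\ 0 < r < 1, forall a, a \in F -> c a / r < 1 &
    \prod_(a <- F) (c a / r) `^ p a <= \prod_(a <- F) c a `^ p a + e].
Proof.
move=> c01 p0 e0.
have [|r0 [/andP[r00 r01] cr]] := @lt1_gap T F c.
  by move=> a /c01/andP[].
set P := \prod_(a <- F) c a `^ p a; pose S := \sum_(a <- F) p a.
have P0 : 0 <= P by apply: prodr_ge0 => a _; exact: powR_ge0.
have S0 : 0 <= S by rewrite /S big_seq; apply: sumr_ge0 => a /p0.
have S1 : 0 < S + 1 by lra.
have P1 : 0 < P + 1 by lra.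
have eta0 : 0 < e / (P + 1) by rewrite divr_gt0.
have ln1 : 0 < ln (1 + e / (P + 1)) by rewrite ln_gt0//; lra.
have lnr : 0 < - ln r0 by rewrite oppr_gt0 ln_lt0// r00.
pose t := Num.min (- ln r0) (ln (1 + e / (P + 1)) / (S + 1)).
have t0 : 0 < t by rewrite lt_min lnr divr_gt0.
have r0t : r0 <= expR (- t).
  by rewrite -[r0]lnK ?posrE// ler_expR lerNr /t ge_min lexx.
exists (expR (- t)); split.
- by rewrite expR_gt0 expR_lt1; lra.
- move=> a aF; rewrite ltr_pdivrMr ?expR_gt0// mul1r.
  by apply: lt_le_trans r0t; exact: cr.
have -> : \prod_(a <- F) (c a / expR (- t)) `^ p a = P * expR (S * t).
  rewrite /P /S mulr_suml (big_morph _ (@expRD R) (@expR0 R)) -big_split /=.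
  rewrite !big_seq; apply: eq_bigr => a /c01/andP[ca _].
  by rewrite expRN invrK powR_dilate.
have h : expR (S * t) <= 1 + e / (P + 1).
  rewrite -[leRHS]lnK ?posrE ?addr_gt0// ler_expR.
  have : t <= ln (1 + e / (P + 1)) / (S + 1) by rewrite /t ge_min lexx orbT.
  rewrite ler_pdivlMr// => h; lra.
apply: le_trans (ler_wpM2l P0 h) _.
rewrite mulrDr mulr1 lerD2l mulrA ler_pdivrMr// mulrC ler_wpM2l//; lra.
Qed.

End Products.

Section Lempert.
Context {R : realType} {n : nat}.
Local Notation C := R[i].
Local Notation V := 'rV[C]_n.
Implicit Types (D B : set V) (p : V -> R) (z : V) (lam : V -> C).

Lemma countable_enum (T : Type) (A : set T) : A !=set0 -> countable A ->
  exists a : nat -> T, (forall k, A (a k)) /\ forall x, A x -> exists k, a k = x.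
Proof.
move=> [x0 Ax0] /countable_injP[f finj].
have /choice[a aP] (k : nat) : exists x, A x /\ forall y, A y -> f y = k -> y = x.
  have [[x [Ax fx]]|no] := pselect (exists x, A x /\ f x = k).
    exists x; split=> // y Ay fy; apply: finj; rewrite ?inE//.
    by rewrite fx fy.
  by exists x0; split=> // y Ay fy; case: no; exists y.
exists a; split=> [k|x Ax]; first by case: (aP k).
by exists (f x); have [_ /(_ x Ax erefl)] := aP (f x).
Qed.

Lemma pole_prod_ge0 D p lam : (0 <= pole_prod D p lam)%E.
Proof.
apply: le_ereal_inf_tmp => _ [F _ <-]; rewrite lee_fin.
by apply: prodr_ge0 => a _; exact: powR_ge0.
Qed.

Lemma factor_lt1 D p lam a : poles D p a -> unit_disc (lam a) ->
  Normc.normc (lam a) `^ p a < 1.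
Proof.
move=> [_ pa] /unit_disc_rnorm l1.
rewrite (_ : 1 = 1 `^ p a); last by rewrite powR1.
rewrite gt0_ltr_powR// ?nnegrE//.
exact: (rnorm_ge0 (lam a)).
Qed.

(** All factors are less than 1, so the poles are the union over k of those whose
    factor is at most 1 - 1 / (k + 1). One of these sets is infinite, and m
    factors from it have product at most q^m. *)
Lemma pole_prod_uncountable D p z psi lam : competitor D p z psi lam ->
  ~ countable (poles D p) -> (pole_prod D p lam <= 0)%E.
Proof.
move=> [_ _ lamP] unc; pose c a := Normc.normc (lam a) `^ p a.
pose S k := [set a | poles D p a /\ c a <= 1 - k.+1%:R^-1].
have [k Sk] : exists k, infinite_set (S k).
  apply: contrapT => /forallNP fin; apply: unc.
  apply: (@sub_countable _ _ _ (\bigcup_k S k)); last first.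
    apply: bigcup_countable => // k _; apply: finite_set_countable.
    by apply: contrapT; exact: fin.
  apply: subset_card_le => a pa.
  have ca : 0 < 1 - c a by rewrite subr_gt0; apply: (factor_lt1 pa); case: (lamP a pa).
  exists (Num.Def.archi_bound (1 - c a)^-1) => //; split=> //.
  set k := Num.Def.archi_bound _.
  have : (1 - c a)^-1 <= k.+1%:R.
    have /archi_boundP : 0 <= (1 - c a)^-1 by rewrite invr_ge0 ltW.
    by move=> /ltW/le_trans; apply; rewrite ler_nat.
  rewrite -lef_pV2 ?posrE ?invr_gt0 ?ltr0n// invrK => h.
  by rewrite lerBrDr addrC -lerBrDr.
pose q : R := 1 - k.+1%:R^-1.
have q01 : 0 <= q < 1.
  rewrite /q subr_ge0 invf_le1 ?ltr0n// ler1n /=.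
  by rewrite gtrBl invr_gt0 ltr0n.
apply/lee_addgt0Pr => e e0; rewrite add0e.
have [m qm] : exists m, q ^+ m <= e.
  have [q0|q0] := eqVneq q 0; first by exists 1%N; rewrite q0 expr0n ltW.
  have [|K KP] := @sq_geometric_lim R q _ e e0.
    by case/andP: q01 => qge0 q1; rewrite q1 andbT lt_neqAle eq_sym q0.
  exists K.+1; apply: le_trans (KP K.+1 (leqnSn K)).
  rewrite ler_peMl ?exprn_ge0//; first by case/andP: q01.
  by rewrite exprn_ege1// ler1n.
have [F FS mF] := infinite_set_fset m Sk.
apply: (@le_trans _ _ (\prod_(a <- F) c a)%:E).
  apply: ereal_inf_lbound; exists F => //= a /FS; by case.
rewrite lee_fin; apply: le_trans qm.
apply: (@le_trans _ _ (q ^+ #|` F|)); last first.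
  by apply: ler_wiXn2l => //; case/andP: q01 => // _ /ltW.
apply: prod_le_exprn => a /FS[_ caq]; rewrite caq andbT; exact: powR_ge0.
Qed.

(** For each finite set F of points of B, the disc psi, dilated by r close to 1,
    is turned into a disc through all the poles with the same values at 0 and at
    the points lam b / r, b in F. All other factors are at most 1. *)
Lemma lempert_inf_le_restr D p z B psi lam : is_domain D ->
  (exists phi lam', competitor D p z phi lam') ->
  B `<=` poles D p -> B !=set0 -> competitor D (restr_poles p B) z psi lam ->
  (lempert_inf D p z <= pole_prod D (restr_poles p B) lam)%E.
Proof.
move=> [D0 oD cD] [phi [lam' phic]] Bp B0 psic.
have [cnt|unc] := pselect (countable (poles D p)); last first.
  apply: le_trans (pole_prod_ge0 _ _ _).
  apply: le_trans (pole_prod_uncountable phic unc).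
  by apply: ereal_inf_lbound; exists phi, lam'.
have pB := poles_restr Bp.
have [a [aP asurj]] : exists a : nat -> V, (forall k, poles D p (a k)) /\
    forall x, poles D p x -> exists k, a k = x.
  by apply: countable_enum => //; case: B0 => x /Bp ?; exists x.
have [hpsi psi0 psil] := psic; rewrite pB in psil.
apply: le_ereal_inf_tmp => _ [F /= FB <-]; rewrite pB in FB.
have -> : \prod_(b <- F) Normc.normc (lam b) `^ restr_poles p B b =
          \prod_(b <- F) Normc.normc (lam b) `^ p b.
  rewrite !big_seq; apply: eq_bigr => b bF; congr (_ `^ _).
  by rewrite /restr_poles indicE mem_set ?mulr1//; exact: FB.
apply/lee_addgt0Pr => e e0.
have [||r [r01 lamr prodr]] :=
  @exists_dilation R _ F (fun b => Normc.normc (lam b)) p e _ _ e0.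
- move=> b /FB/psil[/unit_disc_rnorm l1 _]; apply/andP; split=> //.
  exact: (rnorm_ge0 (lam b)).
- by move=> b /FB/Bp[_ /ltW].
have Dpsi := disc_in_dilation oD hpsi r01; have /andP[r0 r1] := r01.
have lr (b : V) : rnorm (lam b / r%:C) = Normc.normc (lam b) / r.
  by rewrite rnormM rnormV rnormR gtr0_norm.
have [||G [hG Gpsi Gmu]] := @disc_through R n D _
  (0 :: [seq lam b / r%:C | b <- F]) a oD cD Dpsi.
- move=> x; rewrite inE => /orP[/eqP->|/mapP[b bF ->]]; first by rewrite rnorm0.
  by rewrite lr lamr.
- by move=> k; case: (aP k).
(* keep the dilated preimages on [F] and pick any preimage elsewhere *)
have /choice[mu muP] (b : V) : exists m, (b \in F -> m = lam b / r%:C) /\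
    (poles D p b -> unit_disc m /\ G m = b).
  have [bF|bF] := boolP (b \in F).
    exists (lam b / r%:C); split=> // _; split.
      by apply/unit_disc_rnorm; rewrite lr lamr.
    rewrite Gpsi; last by rewrite inE; apply/orP; right; apply/mapP; exists b.
    have -> : r%:C * (lam b / r%:C) = lam b.
      by rewrite mulrC divfK// -[0]/(0%:C) (inj_eq (@complexI R)) gt_eqF.
    by case: (psil b (FB _ bF)).
  have [pb|npb] := pselect (poles D p b); last by exists 0.
  have [k <-] := asurj b pb; have [m m1 Gm] := Gmu k.
  by exists m.
apply: (@le_trans _ _ (pole_prod D p mu)).
  apply: ereal_inf_lbound; exists G, mu; split=> //; split=> //.
    by rewrite Gpsi ?mulr0// inE eqxx.
  by move=> b; case: (muP b).
apply: (@le_trans _ _ (\prod_(b <- F) Normc.normc (mu b) `^ p b)%:E).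
  by apply: ereal_inf_lbound; exists F => //= b /FB/Bp.
rewrite -EFinD lee_fin; apply: le_trans prodr.
rewrite le_eqVlt; apply/orP; left; apply/eqP; rewrite !big_seq; apply: eq_bigr.
by move=> b bF; have [/(_ bF) -> _] := muP b; rewrite -(lr b).
Qed.

End Lempert.

(** * The infimum over finite sets of poles *)

Section Monotonicity.
Context {R : realType} {n : nat}.
Local Notation C := R[i].
Local Notation V := 'rV[C]_n.
Implicit Types (D B : set V) (p : V -> R) (z : V) (lam : V -> C).

Lemma restr_polesK p B B' : B' `<=` B ->
  restr_poles (restr_poles p B) B' = restr_poles p B'.
Proof.
move=> B'B; apply: funext => a; rewrite /restr_poles !indicE.
have [aB'|_] := boolP (a \in B'); last by rewrite !mulr0.
by rewrite (mem_set (B'B _ (set_mem aB'))) mulr1.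
Qed.

Lemma competitor_restr D p z B psi lam : B `<=` poles D p ->
  competitor D p z psi lam -> competitor D (restr_poles p B) z psi lam.
Proof.
by move=> Bp [h0 h1 h2]; split=> // a; rewrite poles_restr// => /Bp/h2.
Qed.

(** A partial product over a finite set F of poles bounds from above the value
    of [lempert_inf] for the weight restricted to F. The empty F, with product 1,
    is replaced by a singleton, whose factor is less than 1. *)
Lemma finite_restr_le_lempert_inf D p z : poles D p !=set0 ->
  (ereal_inf [set lempert_inf D (restr_poles p B) z
     | B in [set B | [/\ B `<=` poles D p, B !=set0 & finite_set B]]]
   <= lempert_inf D p z)%E.
Proof.
move=> [a0 pa0]; apply: le_ereal_inf_tmp => _ [psi [lam [psic ->]]].
apply: le_ereal_inf_tmp => _ [F /= Fp <-].
have [_ _ lamP] := psic.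
have [G [Gp [b bG] GF]] : exists G : {fset V}, [/\ [set` G] `<=` poles D p,
    [set` G] !=set0 & \prod_(a <- G) Normc.normc (lam a) `^ p a <=
                      \prod_(a <- F) Normc.normc (lam a) `^ p a].
  have [F0|[b bF]] := fset_0Vmem F; last by exists F; split=> //; exists b.
  exists [fset a0]%fset; split.
  - by move=> x /=; rewrite inE => /eqP->.
  - by exists a0; rewrite /= inE.
  rewrite F0 big_seq_fset0 big_seq_fset1 ltW// (factor_lt1 pa0)//.
  by case: (lamP a0 pa0).
pose B : set V := [set` G].
apply: (@le_trans _ _ (lempert_inf D (restr_poles p B) z)).
  apply: ereal_inf_lbound; exists B => //; split=> //; [by exists b | exact: finite_fset].
apply: (@le_trans _ _ (pole_prod D (restr_poles p B) lam)).
  by apply: ereal_inf_lbound; exists psi, lam; split=> //; exact: competitor_restr.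
apply: (@le_trans _ _ (\prod_(a <- G) Normc.normc (lam a) `^ p a)%:E).
  apply: ereal_inf_lbound; exists G; first by rewrite /= poles_restr.
  congr (_%:E); rewrite !big_seq; apply: eq_bigr => a aG; congr (_ `^ _).
  by rewrite /restr_poles indicE mem_set ?mulr1.
by rewrite lee_fin.
Qed.

(** This also evaluates [lempert] at a restricted weight, whether or not a disc
    through all of its poles exists. *)
Lemma lempertE D p z : is_domain D -> poles D p !=set0 ->
  lempert D p z = ereal_inf [set lempert_inf D (restr_poles p B) z
     | B in [set B | [/\ B `<=` poles D p, B !=set0 & finite_set B]]].
Proof.
move=> Ddom p0; rewrite /lempert; case: asboolP => // ex.
apply/eqP; rewrite eq_le finite_restr_le_lempert_inf// andbT.
apply: le_ereal_inf_tmp => _ [B [Bp B0 _] <-].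
apply: le_ereal_inf_tmp => _ [psi [lam [psic ->]]].
exact: lempert_inf_le_restr psic.
Qed.

Lemma lempert_le_restr D p z B : is_domain D -> B `<=` poles D p -> B !=set0 ->
  (lempert D p z <= lempert D (restr_poles p B) z)%E.
Proof.
move=> Ddom Bp B0; have pB := poles_restr Bp.
have p0 : poles D p !=set0 by case: B0 => a /Bp; exists a.
rewrite !lempertE ?pB//; apply: le_ereal_inf => _ [B' [B'B B'0 fB'] <-].
exists B'; last by rewrite restr_polesK.
by split=> // a /B'B/Bp.
Qed.

Lemma lempert_restr_le_inf D p z B : is_domain D -> B `<=` poles D p ->
  B !=set0 -> finite_set B ->
  (lempert D (restr_poles p B) z <= lempert_inf D (restr_poles p B) z)%E.
Proof.
move=> Ddom Bp B0 fB; have pB := poles_restr Bp.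
rewrite lempertE ?pB//; apply: ereal_inf_lbound; exists B; last by rewrite restr_polesK.
by split.
Qed.

End Monotonicity.

Theorem theorem5p1 (R : realType) (n : nat) (D : set 'rV[R[i]]_n)
    (p : 'rV[R[i]]_n -> R) (D_dom : is_domain D)
    (p_ge0 : forall a, D a -> 0 <= p a)
    (p_neq0 : exists a, D a /\ p a <> 0) :
  (forall z, D z ->
    lempert D p z =
    ereal_inf [set lempert D (restr_poles p B) z
              | B in [set B | [/\ B `<=` poles D p, B !=set0 & finite_set B]]])
  /\
  (forall z, D z ->
    lempert D p z =
    ereal_inf [set lempert D (restr_poles p B) z
              | B in [set B | B `<=` poles D p /\ B !=set0]]).
Proof.
have p0 : poles D p !=set0.
  case: p_neq0 => a [Da pa]; exists a; split=> //.
  by rewrite lt_neqAle p_ge0// andbT eq_sym; apply/eqP.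
have fin_le z : (ereal_inf [set lempert D (restr_poles p B) z
    | B in [set B | [/\ B `<=` poles D p, B !=set0 & finite_set B]]]
    <= lempert D p z)%E.
  rewrite lempertE//; apply: le_ereal_inf_tmp => _ [B [Bp B0 fB] <-].
  apply: le_trans (lempert_restr_le_inf z D_dom Bp B0 fB).
  by apply: ereal_inf_lbound; exists B.
split=> z _; apply/eqP; rewrite eq_le; apply/andP; split.
- by apply: le_ereal_inf_tmp => _ [B [Bp B0 _] <-]; exact: lempert_le_restr.
- exact: fin_le.
- by apply: le_ereal_inf_tmp => _ [B [Bp B0] <-]; exact: lempert_le_restr.
apply: le_trans (fin_le z); apply: le_ereal_inf => _ [B [Bp B0 _] <-].
by exists B.
Qed.
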